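(* Let $m=2$, let $\lambda=(\lambda_1,\lambda_2)\in\mathbb{N}^2$ be a partition, and let $\ell\geq d(\lambda)$ be a positive integer. Then for generic $z=(z_1,\ldots,z_{|\lambda|})$, the functions $Q(\mathcal{U})$, for all different choices of admissible partitionings $\mathcal{U}$ of $\{1,\ldots,|\lambda|\}$, span the space of conformal blocks $CB^\ell_z(\lambda)$.
   Context: $\mathbb{N}=\{0,1,2,\ldots\}$. For a partition $\lambda=(\lambda_1\geq\lambda_2)\in\mathbb{N}^2$ write $|\lambda|=\lambda_1+\lambda_2$ and $d(\lambda)=\lambda_1-\lambda_2$. Tuples $z=(z_1,\ldots,z_{|\lambda|})$ consist of pairwise distinct complex numbers; ''generic $z$'' means all such $z$ in some nonempty Zariski open subset. Let $V^{\otimes|\lambda|}$ denote the space of complex polynomials in the variables $y^{(1)}_a,y^{(2)}_a$ ($1\le a\le|\lambda|$) that are homogeneous of degree 1 in the pair $y^{(1)}_a,y^{(2)}_a$ for each $a$. Put $$e_{i,j}=\sum_{a=1}^{|\lambda|}y^{(i)}_a\frac{\partial}{\partial y^{(j)}_a},\qquad e^{z}_{i,j}=\sum_{a=1}^{|\lambda|}z_a\,y^{(i)}_a\frac{\partial}{\partial y^{(j)}_a}.$$ Let $SV(\lambda)=\{p\in V^{\otimes|\lambda|} : e_{1,2}p=0,\ e_{i,i}p=\lambda_i p \text{ for } i=1,2\}$, and for a positive integer $\ell\geq d(\lambda)$ define the space of conformal blocks at level $\ell$, $$CB^\ell_z(\lambda)=\{p\in SV(\lambda) : (e^z_{1,2})^{\ell-d(\lambda)+1}p=0\}.$$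 For finite index sets $I,J$, let $R(z_I|z_J)=\prod_{a\in I}\prod_{b\in J}(z_a-z_b)$. For a partition $\mu\in\mathbb{N}^2$ define $$P_z(\mu)=\sum_{(I_1,I_2)}\frac{\prod_{a\in I_1}y^{(1)}_a\prod_{a\in I_2}y^{(2)}_a}{R(z_{I_1}|z_{I_2})},$$ the sum over ordered pairs of disjoint sets with $I_1\cup I_2=\{1,\ldots,|\mu|\}$, $|I_j|=\mu_j$. For pairwise different integers $k_1,\ldots,k_{|\mu|}$, let $P^{(k_1,\ldots,k_{|\mu|})}(\mu)$ be obtained from $P_z(\mu)$ by substituting $y^{(j)}_{k_a}$ for $y^{(j)}_a$ and $z_{k_a}$ for $z_a$ for all $j,a$. A partitioning $\mathcal{U}=\{U_1,\ldots,U_\ell\}$ of $\{1,\ldots,|\lambda|\}$ into $\ell$ (possibly empty) subsets is admissible if exactly $d(\lambda)$ of the sets $U_i$ have odd cardinality and exactly $\ell-d(\lambda)$ have even cardinality. Each $U_j$ is regarded as an ordered set with the natural order of integers. Let $\mu^{(j)}\in\mathbb{N}^2$ be the unique partition with $|\mu^{(j)}|=|U_j|$ and $d(\mu^{(j)})\in\{0,1\}$. Define $$Q(\mathcal{U})=\prod_{j=1}^{\ell}P^{(U_j)}(\mu^{(j)}).$$ *)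

(* Defs.v *)
From mathcomp Require Import all_boot all_order all_algebra.
From mathcomp Require Import complex mpoly reals.

Set Implicit Arguments.
Unset Strict Implicit.
Unset Printing Implicit Defensive.

Import GRing.Theory.

(* The index set {1, ..., n} is 'I_n, and the superscript or subscript
   i = 1, 2 is an element of 'I_2, with i1 and i2 standing for 1 and 2. *)
Local Notation i1 := (ord0 : 'I_2).
Local Notation i2 := (ord_max : 'I_2).

Definition is_partition (mu : nat * nat) : bool := mu.2 <= mu.1.
Definition psize (mu : nat * nat) : nat := mu.1 + mu.2.
Definition pdiff (mu : nat * nat) : nat := mu.1 - mu.2.

Definition balanced (n : nat) : nat * nat := (uphalf n, n./2).

Lemma psize_balanced n : psize (balanced n) = n.
Proof. by rewrite /psize /= uphalf_half -addnA addnn odd_double_half. Qed.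

Lemma balancedP n (mu : nat * nat) :
  [/\ is_partition mu, psize mu = n & pdiff mu <= 1] <-> mu = balanced n.
Proof.
rewrite /is_partition /pdiff; split => [[le21 <- d1]|->].
  case: mu le21 d1 => a b /= le21; rewrite /balanced /psize /= leq_subLR => d1.
  have [-> | ltba] := eqVneq a b.
    by rewrite uphalf_half addnn odd_double doubleK.
  have -> : a = b.+1 by apply/eqP; rewrite eqn_leq -addn1 d1 addn1 ltn_neqAle eq_sym ltba.
  by rewrite addSn addnn /= doubleK uphalf_half odd_double doubleK.
split; [| exact: psize_balanced |]; rewrite /= uphalf_half.
  exact: leq_addl.
by rewrite addnK; case: (odd n).
Qed.

Local Open Scope ring_scope.

Section ConformalBlocks.

Variables (K : fieldType) (n : nat).

(* y i a is the variable y^(i)_a; mxvec_index is the bijection from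
   pairs 'I_2 * 'I_n to 'I_(2 * n). *)
Definition y (i : 'I_2) (a : 'I_n) : {mpoly K[2 * n]} := 'X_(mxvec_index i a).

Definition dy (i : 'I_2) (a : 'I_n) (p : {mpoly K[2 * n]}) : {mpoly K[2 * n]} :=
  mderiv (mxvec_index i a) p.

Definition Vtensor (p : {mpoly K[2 * n]}) : Prop :=
  forall m, m \in msupp p ->
  forall a : 'I_n, (m (mxvec_index i1 a) + m (mxvec_index i2 a))%N = 1%N.

Definition e (i j : 'I_2) (p : {mpoly K[2 * n]}) : {mpoly K[2 * n]} :=
  \sum_(a < n) y i a * dy j a p.

Definition ez (z : 'I_n -> K) (i j : 'I_2) (p : {mpoly K[2 * n]}) :
    {mpoly K[2 * n]} :=
  \sum_(a < n) z a *: (y i a * dy j a p).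

Definition SV (lam : nat * nat) (p : {mpoly K[2 * n]}) : Prop :=
  [/\ Vtensor p, e i1 i2 p = 0,
      e i1 i1 p = lam.1%:R *: p & e i2 i2 p = lam.2%:R *: p].

(* Only meaningful for pdiff lam <= l, as the subtraction is truncated. *)
Definition CB (z : 'I_n -> K) (l : nat) (lam : nat * nat)
    (p : {mpoly K[2 * n]}) : Prop :=
  SV lam p /\ iter (l - pdiff lam + 1)%N (ez z i1 i2) p = 0.

Definition Rprod (m : nat) (z : 'I_m -> K) (I J : {set 'I_m}) : K :=
  \prod_(a in I) \prod_(b in J) (z a - z b).

(* P k z is the polynomial P^(k_1, ..., k_|mu|)(mu): P_z(mu) with y^(j)_(k_a)
   and z_(k_a) substituted for y^(j)_a and z_a. The case k = id is P_z(mu). *)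
Definition P (mu : nat * nat) (k : 'I_(psize mu) -> 'I_n) (z : 'I_n -> K) :
    {mpoly K[2 * n]} :=
  \sum_(I : {set 'I_(psize mu)} * {set 'I_(psize mu)} |
         [&& [disjoint I.1 & I.2], I.1 :|: I.2 == setT,
             #|I.1| == mu.1 & #|I.2| == mu.2])
    (Rprod (z \o k) I.1 I.2)^-1 *:
      ((\prod_(a in I.1) y i1 (k a)) * (\prod_(a in I.2) y i2 (k a))).

(* Lists the elements of A in increasing order. *)
Definition set_index (A : {set 'I_n}) (a : 'I_(psize (balanced #|A|))) : 'I_n :=
  enum_val (cast_ord (psize_balanced #|A|) a).

(* Partitionings are encoded as families labelled by 'I_l; Q does not depend
   on the labelling, so neither does the span of the Q z U. *)
Definition admissible (l : nat) (lam : nat * nat)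
    (U : {ffun 'I_l -> {set 'I_n}}) : bool :=
  [&& [forall i, forall j, (i != j) ==> [disjoint U i & U j]],
      \bigcup_i U i == setT,
      #|[set i | odd #|U i|]| == pdiff lam
    & #|[set i | ~~ odd #|U i|]| == (l - pdiff lam)%N].

Definition Q (l : nat) (z : 'I_n -> K) (U : {ffun 'I_l -> {set 'I_n}}) :
    {mpoly K[2 * n]} :=
  \prod_(j < l) P (@set_index (U j)) z.

End ConformalBlocks.

Definition spans (K : fieldType) (E : lmodType K) (I : finType) (A : pred I)
    (v : I -> E) (W : E -> Prop) : Prop :=
  forall p : E, W p <-> exists c : I -> K, p = \sum_(i | A i) c i *: v i.

(* The complement of the common zero locus of a set S of polynomials. *)
Definition zariski_open (K : fieldType) (n : nat) (O : ('I_n -> K) -> Prop) :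
    Prop :=
  exists S : {mpoly K[n]} -> Prop,
    forall z, O z <-> exists2 f, S f & f.@[z] != 0.

Definition generically (K : fieldType) (n : nat) (T : ('I_n -> K) -> Prop) :
    Prop :=
  exists O : ('I_n -> K) -> Prop,
    [/\ zariski_open O, exists z, O z
      & forall z, O z -> injective z -> T z].

(* Main.v *)
(* With y^(1) = 1 and y^(2)_a = x_a, the conformal blocks become the multilinear
   polynomials p in the x_a, homogeneous of degree lambda_2, that are killed by
   D = sum_a d/dx_a and by E^s, where E = sum_a z_a d/dx_a and
   s = l - d(lambda) + 1. By Lagrange interpolation D kills every P^(U), E kills
   P^(U) for odd #U, and E^2 kills P^(U) for even #U; hence by the Leibniz rule
   Q(U) is a conformal block.

   Spanning is by induction on the set of points. In homogeneous coordinates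
   z_a = v_a / u_a one may put the point n at infinity (u_n = 0, v_n = 1). Writing
   p = A + x_n B, the polynomial A is a conformal block for the other points with
   d replaced by d - 1; it is a combination of some Q(U'), and adding n to an even
   part of U' gives Q(U) with the same component A. Once these are subtracted,
   B is a conformal block with d replaced by d + 1, and one adds n to an odd part.
   Finally, the dimension of the solution space of a linear system is upper
   semicontinuous and the rank of a family of solutions is lower semicontinuous,
   so spanning passes from one position of the points (first from z_n = infinity
   to generic z_n, then from one z to generic z). *)
Require Import Defs.
From mathcomp Require Import all_boot all_order all_algebra.
From mathcomp Require Import complex mpoly reals.
From mathcomp Require Import boolp.
From mathcomp Require Import zify ring.

Set Implicit Arguments.
Unset Strict Implicit.
Unset Printing Implicit Defensive.

Import Order.TTheory GRing.Theory Num.Theory.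
Local Open Scope ring_scope.

(** * Semicontinuity of solution spaces *)

Section RankSemicontinuity.
Variables (S : comNzRingType) (K : fieldType).

(** [S] plays the role of a ring of parameters and [ev] of the evaluation at a point. The witness is
    a maximal minor of [A] that is nonzero at [ev0]; wherever it stays nonzero it certifies the same
    rank. *)
Lemma minor_rank_open m n (A : 'M[S]_(m, n)) (ev0 : {rmorphism S -> K}) :
  exists2 f : S, ev0 f != 0 &
    forall ev : {rmorphism S -> K}, ev f != 0 ->
      (\rank (map_mx ev0 A) <= \rank (map_mx ev A))%N.
Proof.
set A0 := map_mx ev0 A; set r := \rank A0.
have rowsubP p q p' (h : 'I_p' -> 'I_p) (B : 'M[K]_(p, q)) : (rowsub h B <= B)%MS.
  by apply/row_subP => i; rewrite row_rowsub row_sub.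
have [h hfree] : exists h : 'I_r -> 'I_m, row_free (rowsub h A0).
  exists (maxrankfun A0); exact: maxrowsub_free.
have [g gfree] : exists g : 'I_r -> 'I_n, row_free (rowsub g (rowsub h A0)^T).
  have e : \rank (rowsub h A0)^T = r by rewrite mxrank_tr; apply/eqP.
  have := maxrowsub_free (rowsub h A0)^T; move: (maxrankfun _).
  by rewrite e => g ?; exists g.
have rk_le (ev : {rmorphism S -> K}) :
    \det (rowsub g (rowsub h (map_mx ev A))^T) != 0 -> (r <= \rank (map_mx ev A))%N.
  move=> d0; have : rowsub g (rowsub h (map_mx ev A))^T \in unitmx.
    by rewrite unitmxE unitfE.
  rewrite -row_free_unit => /eqP rk; rewrite -{1}rk.
  by rewrite (leq_trans (mxrankS (rowsubP _ _ _ _ _))) // mxrank_tr mxrankS.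
exists (\det (rowsub g (rowsub h A)^T)) => [|ev].
  rewrite -det_map_mx map_mxsub -map_trmx map_mxsub -unitfE -unitmxE -row_free_unit.
  exact: gfree.
by rewrite -det_map_mx map_mxsub -map_trmx map_mxsub => /rk_le.
Qed.

(* Both the corank of the equations and the rank of the generators can only
   improve under a perturbation, so a spanning family of solutions remains
   spanning as long as it remains a family of solutions. *)
Lemma spanning_open (I J L : finType) (M : J -> I -> S) (G : L -> I -> S)
    (ev0 : {rmorphism S -> K}) :
  (forall c : I -> K, (forall j, \sum_i ev0 (M j i) * c i = 0) ->
     exists b : L -> K, forall i, c i = \sum_l b l * ev0 (G l i)) ->
  exists2 f : S, ev0 f != 0 & forall ev : {rmorphism S -> K}, ev f != 0 ->
    (forall l j, \sum_i ev (M j i) * ev (G l i) = 0) ->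
    forall c : I -> K, (forall j, \sum_i ev (M j i) * c i = 0) ->
     exists b : L -> K, forall i, c i = \sum_l b l * ev (G l i).
Proof.
move=> span0.
pose mM : 'M[S]_(#|I|, #|J|) := \matrix_(i, j) M (enum_val j) (enum_val i).
pose mG : 'M[S]_(#|L|, #|I|) := \matrix_(l, i) G (enum_val l) (enum_val i).
pose row_of (c : I -> K) : 'rV[K]_#|I| := \row_i c (enum_val i).
have solP (ev : {rmorphism S -> K}) c :
    (forall j, \sum_i ev (M j i) * c i = 0) <-> row_of c *m map_mx ev mM = 0.
  have colE j : \sum_i ev (M (enum_val j) i) * c i
      = (row_of c *m map_mx ev mM) 0 j.
    rewrite mxE big_enum_val /=; apply: eq_bigr => i _.
    by rewrite !mxE mulrC.
  split=> [sol | e0 j]; first by apply/rowP => j; rewrite -colE sol mxE.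
  by have := colE (enum_rank j); rewrite enum_rankK e0 mxE.
have spanP (ev : {rmorphism S -> K}) c :
    (exists b : L -> K, forall i, c i = \sum_l b l * ev (G l i)) <->
    (row_of c <= map_mx ev mG)%MS.
  split=> [[b bE] | /submxP [D DE]].
    apply/submxP; exists (\row_l b (enum_val l)); apply/rowP => i.
    rewrite !mxE bE [LHS]big_enum_val; apply: eq_bigr => l _.
    by rewrite !mxE.
  exists (fun l => D 0 (enum_rank l)) => i.
  have /rowP /(_ (enum_rank i)) := DE; rewrite !mxE enum_rankK => ->.
  rewrite [RHS]big_enum_val; apply: eq_bigr => l _.
  by rewrite !mxE enum_valK enum_rankK.
have rowK (v : 'rV[K]_#|I|) : row_of (fun i => v 0 (enum_rank i)) = v.
  by apply/rowP => i; rewrite mxE enum_valK.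
have [f1 f10 f1P] := minor_rank_open mM ev0.
have [f2 f20 f2P] := minor_rank_open mG ev0.
exists (f1 * f2) => [|ev]; first by rewrite rmorphM mulf_neq0.
rewrite rmorphM mulf_eq0 negb_or => /andP [/f1P rkM /f2P rkG] solG c /solP solc.
apply/spanP.
have sub0 : (kermx (map_mx ev0 mM) <= map_mx ev0 mG)%MS.
  apply/row_subP => i; rewrite -[row i _]rowK; apply/spanP/span0/solP.
  by rewrite rowK; apply/sub_kermxP; rewrite row_sub.
have sub : (map_mx ev mG <= kermx (map_mx ev mM))%MS.
  apply/row_subP => l; apply/sub_kermxP.
  have -> : row l (map_mx ev mG) = row_of (fun i => ev (G (enum_val l) i)).
    by apply/rowP => i; rewrite !mxE.
  by apply/solP => j; exact: solG.
(* Dimension count: the kernel at [ev] is no larger than the kernel at [ev0], which is no larger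
   than the rank of [mG] at [ev0], hence than its rank at [ev]. So the inclusion [sub] is an
   equality. *)
have /eqmxP : (map_mx ev mG == kermx (map_mx ev mM))%MS.
  rewrite -(geq_leqif (mxrank_leqif_eq sub)) mxrank_ker.
  have := mxrankS sub0; rewrite mxrank_ker; have := rank_leq_row (map_mx ev mM).
  have := rank_leq_row (map_mx ev0 mM); lia.
by move=> eq; rewrite eq; apply/sub_kermxP.
Qed.

End RankSemicontinuity.

(** * Lowering operators on coefficient functions *)

Section Lowering.
Variables (S : comNzRingType) (T : finType).
Implicit Types (w : T -> S) (c : {set T} -> S) (I J X : {set T}) (a n : T).

(* c J is the coefficient of prod_(a in J) x_a in a multilinear polynomial, and
   lower w is the derivation sum_a w_a d/dx_a. *)
Definition lower w c J : S := \sum_(a | a \notin J) w a * c (a |: J).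

Lemma lowerE w c J : lower w c J = \sum_(a | a \notin J) w a * c (a |: J).
Proof. by []. Qed.

Definition delta I J : S := (I == J)%:R.

Lemma iter_lowerE w s c J :
  iter s (lower w) c J = \sum_I c I * iter s (lower w) (delta I) J.
Proof.
elim: s J => [|s IH] J /=.
  rewrite (bigD1 J) //= /delta eqxx mulr1 big1 ?addr0 // => I /negPf ->.
  by rewrite mulr0.
rewrite lowerE; under [LHS]eq_bigr do rewrite IH mulr_sumr.
rewrite exchange_big /=; apply: eq_bigr => I _; rewrite lowerE mulr_sumr.
by apply: eq_bigr => a _; rewrite mulrCA.
Qed.

Lemma eq_lower_supp w w' n c : (forall a, a != n -> w a = w' a) ->
  (forall J, n \in J -> c J = 0) -> lower w c = lower w' c.
Proof.
move=> ww' c0; apply/funext => J; apply: eq_bigr => a _.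
by have [->|/ww' -> //] := eqVneq a n; rewrite c0 ?setU11 // !mulr0.
Qed.

Lemma lower_supp w n c : (forall J, n \in J -> c J = 0) ->
  forall J, n \in J -> lower w c J = 0.
Proof.
by move=> c0 J nJ; apply: big1 => a _; rewrite c0 ?mulr0 // setU1r.
Qed.

(** Such a [c] is a polynomial free of x_n, so d/dx_n, and with it the weight at [n], does not
    matter. *)
Lemma eq_iter_lower_supp w w' n c s : (forall a, a != n -> w a = w' a) ->
  (forall J, n \in J -> c J = 0) -> iter s (lower w) c = iter s (lower w') c.
Proof.
move=> ww' c0; elim: s c c0 => // s IH c c0; rewrite !iterSr.
rewrite (eq_lower_supp ww' c0); apply: IH; exact: lower_supp.
Qed.

(* In terms of polynomials, c = c_A + x_n c_B with c_A and c_B free of x_n. *)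
Definition part_without n c J : S := if n \in J then 0 else c J.
Definition part_with n c J : S := if n \in J then 0 else c (n |: J).

Lemma part_with_lower w n c :
  part_with n (lower w c) = lower w (part_with n c).
Proof.
apply/funext => J; rewrite /part_with /lower; case: ifPn => nJ.
  by rewrite big1 // => a _; rewrite setU1r ?mulr0.
rewrite [RHS](bigD1 n) //= setU11 mulr0 add0r.
apply: eq_big => [a | a]; rewrite !inE negb_or; first by rewrite andbC.
by case/andP => an aJ; rewrite eq_sym (negPf an) (negPf nJ) /= setUCA.
Qed.

Lemma part_without_lower w n c J : part_without n (lower w c) J =
  lower w (part_without n c) J + w n * part_with n c J.
Proof.
rewrite /part_without /part_with /lower; case: ifPn => nJ.
  by rewrite big1 ?mulr0 ?addr0 // => a _; rewrite setU1r ?mulr0.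
rewrite (bigD1 n) //= [X in _ = X + _](bigD1 n) //= setU11 mulr0 add0r addrC.
congr (_ + _); apply: eq_bigr => a /andP [aJ an].
by rewrite !inE eq_sym (negPf an) (negPf nJ).
Qed.

Lemma part_with_iter w n c s :
  part_with n (iter s (lower w) c) = iter s (lower w) (part_with n c).
Proof. by elim: s => //= s IH; rewrite part_with_lower IH. Qed.

(** For D = [lower w], the power D^s sends x_n B to x_n D^s B + s w_n D^(s-1) B, because D^2 x_n =
    0. At [s = 0] the factor [s%:R] hides the truncated [s.-1]. *)
Lemma part_without_iter w n c s J : part_without n (iter s (lower w) c) J =
  iter s (lower w) (part_without n c) J
  + s%:R * w n * iter s.-1 (lower w) (part_with n c) J.
Proof.
elim: s J => [|s IH] J; first by rewrite !mul0r addr0.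
rewrite /= part_without_lower part_with_iter.
have -> : part_without n (iter s (lower w) c) = (fun J =>
  iter s (lower w) (part_without n c) J
  + s%:R * w n * iter s.-1 (lower w) (part_with n c) J).
  by apply/funext => I; exact: IH.
rewrite lowerE; under eq_bigr do rewrite mulrDr.
rewrite big_split /= -addrA; congr (_ + _).
case: s {IH} => [|s] /=.
  by rewrite big1 ?add0r ?mul1r // => a _; rewrite !mul0r mulr0.
rewrite -[in RHS]natr1 !mulrDl mul1r; congr (_ + _).
by rewrite lowerE mulr_sumr; apply: eq_bigr => a _; rewrite mulrCA.
Qed.

Lemma split_partsE n c J :
  c J = if n \in J then part_with n c (J :\ n) else part_without n c J.
Proof.
rewrite /part_with /part_without !inE eqxx /=.
by case: ifPn => [nJ|/negPf ->] //; rewrite setD1K.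
Qed.

(** Chain rule for the substitution of w'_a x_a for x_a. *)
Lemma lower_scale (w w' : T -> S) s c J :
  iter s (lower w) (fun I => (\prod_(a in I) w' a) * c I) J =
  (\prod_(a in J) w' a) * iter s (lower (fun a => w a * w' a)) c J.
Proof.
elim: s J => // s IH J /=; rewrite !lowerE mulr_sumr; apply: eq_bigr => a aJ.
rewrite IH big_setU1 //=; ring.
Qed.

Definition wt X k J := (J \subset X) && (#|J| == k).

(* u and v are homogeneous coordinates of the points, z_a = v_a / u_a. *)
Definition blocks (u v : T -> S) X (k s : nat) c : Prop :=
  [/\ forall J, ~~ wt X k J -> c J = 0,
      forall J, lower u c J = 0
    & forall J, iter s (lower v) c J = 0].

(** The matrix of the linear system behind [blocks], with one row per condition and one column per
    coefficient [c I]: the shape that [spanning_open] takes. *)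
Definition blocks_eqn (u v : T -> S) X (k s : nat)
    (j : {set T} + {set T} + {set T}) I : S :=
  match j with
  | inl (inl J) => (~~ wt X k J)%:R * delta J I
  | inl (inr J) => lower u (delta I) J
  | inr J => iter s (lower v) (delta I) J
  end.

Lemma blocksP u v X k s c :
  blocks u v X k s c <-> forall j, \sum_I blocks_eqn u v X k s j I * c I = 0.
Proof.
have E1 J : \sum_I blocks_eqn u v X k s (inl (inl J)) I * c I
    = (~~ wt X k J)%:R * c J.
  rewrite (bigD1 J) //= /delta eqxx mulr1 big1 ?addr0 // => I.
  by rewrite eq_sym => /negPf ->; rewrite mulr0 mul0r.
have E2 J : \sum_I blocks_eqn u v X k s (inl (inr J)) I * c I = lower u c J.
  by rewrite -[RHS]/(iter 1 _ _ _) iter_lowerE; apply: eq_bigr => I; rewrite mulrC.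
have E3 J : \sum_I blocks_eqn u v X k s (inr J) I * c I = iter s (lower v) c J.
  by rewrite iter_lowerE; apply: eq_bigr => I; rewrite mulrC.
split=> [[c1 c2 c3] [[J|J]|J] | c0].
- by rewrite E1; case: (boolP (wt X k J)) => wtJ; rewrite ?mul0r // c1 ?mulr0.
- by rewrite E2.
- by rewrite E3.
split=> [J wtJ | J | J]; [ | by rewrite -E2 c0 | by rewrite -E3 c0].
by have := c0 (inl (inl J)); rewrite E1 wtJ mul1r.
Qed.

Lemma blocks_sub (L : finType) u v X k s c (b : L -> S) (q : L -> {set T} -> S) :
  blocks u v X k s c -> (forall l, blocks u v X k s (q l)) ->
  blocks u v X k s (fun J => c J - \sum_l b l * q l J).
Proof.
move=> /blocksP c0 q0; apply/blocksP => j.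
under eq_bigr do rewrite mulrBr; rewrite big_split /= c0 add0r sumrN.
under eq_bigr do rewrite mulr_sumr; rewrite exchange_big big1 ?oppr0 //= => l _.
have /blocksP := q0 l; move/(_ j) => e; rewrite -[RHS](mulr0 (b l)) -[X in _ * X]e.
by rewrite mulr_sumr; apply: eq_bigr => I _; rewrite mulrCA.
Qed.

Lemma blocks_sum (L : finType) u v X k s (b : L -> S) (q : L -> {set T} -> S) :
  (forall l, blocks u v X k s (q l)) ->
  blocks u v X k s (fun J => \sum_l b l * q l J).
Proof.
move=> q0; have z0 : blocks u v X k s (fun=> 0).
  by apply/blocksP => j; rewrite big1 // => I _; rewrite mulr0.
have := blocks_sub (fun l => - b l) z0 q0.
congr blocks; apply/funext => J; rewrite sub0r -sumrN.
by apply: eq_bigr => l _; rewrite mulNr opprK.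
Qed.

End Lowering.

Lemma iter_lower_rmorph (S S' : comNzRingType) (T : finType)
    (f : {rmorphism S -> S'}) (w : T -> S) s c J :
  f (iter s (lower w) c J) = iter s (lower (f \o w)) (f \o c) J.
Proof.
elim: s J => //= s IH J; rewrite !lowerE rmorph_sum.
by apply: eq_bigr => a _; rewrite rmorphM IH.
Qed.

Lemma blocks_eqn_rmorph (S S' : comNzRingType) (T : finType)
    (f : {rmorphism S -> S'}) (u v : T -> S) X k s j I :
  f (blocks_eqn u v X k s j I) = blocks_eqn (f \o u) (f \o v) X k s j I.
Proof.
have fdelta : f \o delta S I = delta S' I.
  by apply/funext => J /=; rewrite rmorph_nat.
case: j => [[J|J]|J] /=.
- by rewrite rmorphM !rmorph_nat.
- by rewrite -[LHS]/(f (iter 1 (lower u) _ J)) iter_lower_rmorph fdelta.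
- by rewrite iter_lower_rmorph fdelta.
Qed.

(** * Degrees of the two components, and injectivity of lowering in high degree *)

Section FieldBlocks.
Variables (K : numFieldType) (T : finType).
Implicit Types (X J : {set T}) (c : {set T} -> K).

Lemma part_without_supp (n : T) X k c :
  (forall J, ~~ wt (n |: X) k J -> c J = 0) ->
  forall J, ~~ wt X k J -> part_without n c J = 0.
Proof.
move=> c0 J wtJ; rewrite /part_without; case: ifPn => // nJ; apply: c0.
apply: contra wtJ => /andP [JX Jk]; rewrite /wt Jk andbT.
apply/subsetP => a aJ; have /setU1P [an|//] := subsetP JX a aJ.
by rewrite -an aJ in nJ.
Qed.

Lemma part_with_supp (n : T) X k c :
  (forall J, ~~ wt (n |: X) k J -> c J = 0) ->
  forall J, ~~ ((0 < k)%N && wt X k.-1 J) -> part_with n c J = 0.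
Proof.
move=> c0 J wtJ; rewrite /part_with; case: ifPn => // nJ; apply: c0.
apply: contra wtJ => /andP [JX]; rewrite cardsU1 nJ => /eqP <- /=.
rewrite /wt eqxx andbT; apply/subsetP => a aJ.
have /subsetP /(_ a) := JX; rewrite !inE aJ orbT => /(_ isT) /orP [/eqP an|//].
by rewrite -an aJ in nJ.
Qed.

(* This is sl_2 theory, needed for j = 1 only; the induction on X requires every
   power of the lowering operator. *)
Lemma iter_lower_inj X k j c : (#|X| + j <= k.*2)%N ->
  (forall J, ~~ wt X k J -> c J = 0) ->
  (forall J, iter j (lower (fun=> 1)) c J = 0) -> forall J, c J = 0.
Proof.
move=> + c0; have [m] := ubnP #|X|; elim: m => // m IH in X k j c c0 *.
rewrite ltnS => cX; case: j => [|j] Xjk d0 //.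
have [X0|[n nX]] := set_0Vmem X.
  move=> J; apply: c0; apply/andP => -[].
  by rewrite X0 subset0 => /eqP ->; rewrite cards0; move: Xjk; lia.
have cX' : #|X| = #|X :\ n|.+1 by rewrite (cardsD1 n) nX.
have {}c0 J : ~~ wt (n |: (X :\ n)) k J -> c J = 0 by rewrite setD1K //; exact: c0.
have A0 J : part_without n c J = 0.
  (* Write c = A + x_n B. The x_n part of D^(j+1) c = 0 is D^(j+1) B = 0, so the contribution of x_n
     B to D^(j+2) c has no x_n-free part and D^(j+2) A = 0. *)
  apply: (IH (X :\ n) k j.+2); try lia.
    exact: part_without_supp c0.
  move=> I; have d2 : iter j.+2 (lower (fun=> 1)) c I = 0.
    by rewrite iterS lowerE big1 // => a _; rewrite d0 mulr0.
  have := part_without_iter (fun=> 1) n c j.+2 I.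
  rewrite -[j.+2.-1]/j.+1 -part_with_iter /part_with /part_without d0 d2.
  by rewrite !if_same mulr0 addr0.
have B0 J : part_with n c J = 0.
  case: k => [|k] in Xjk c0 *.
    by apply: (part_with_supp c0).
  apply: (IH (X :\ n) k j); try (move: Xjk; rewrite ?doubleS; lia).
    move=> I wtI; exact: (part_with_supp c0).
  (* Now A = 0, and the x_n-free part of D^(j+1) (x_n B) is (j+1) D^j B; characteristic zero allows
     division by j+1. *)
  move=> I; have := part_without_iter (fun=> 1) n c j.+1 I.
  have -> : part_without n c = fun=> 0 by apply/funext.
  have -> : iter j.+1 (lower (fun=> 1)) (fun=> 0 : K) I = 0.
    by rewrite iter_lowerE big1 // => L _; rewrite mul0r.
  rewrite /part_without d0 if_same add0r mulr1 => /esym/eqP.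
  by rewrite mulf_eq0 pnatr_eq0 => /eqP.
by move=> J; rewrite (split_partsE n) A0 B0 if_same.
Qed.

End FieldBlocks.

(** * Products and Lagrange interpolation *)

Section Products.
Variables (S : comNzRingType) (T : finType) (l : nat).
Implicit Types (w : T -> S) (U : 'I_l -> {set T}) (c : 'I_l -> {set T} -> S).
Implicit Types (I J X : {set T}).

Definition disjoint_family U :=
  [forall i, forall j, (i != j) ==> [disjoint U i & U j]].

Lemma disjoint_familyP U :
  reflect (forall i j, i != j -> [disjoint U i & U j]) (disjoint_family U).
Proof.
apply: (iffP forallP) => [dU i j ij | dU i].
  by have /forallP /(_ j) := dU i; rewrite ij.
by apply/forallP => j; apply/implyP; exact: dU.
Qed.

(* The coefficient at J of a product of polynomials f_i in the variables
   indexed by U i, where c i is the coefficient function of f_i. *)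
Definition prod_coef U c J : S :=
  (J \subset \bigcup_i U i)%:R * \prod_i c i (J :&: U i).

Lemma prod_coef_scale U c (k : 'I_l -> S) J :
  prod_coef U (fun i I => k i * c i I) J = (\prod_i k i) * prod_coef U c J.
Proof. by rewrite /prod_coef big_split /= mulrCA. Qed.

(** Leibniz rule: each variable occurs in exactly one factor, so the sum over [a] splits according
    to the block that contains [a]. *)
Lemma lower_prod_coef U c w J : disjoint_family U ->
  (forall i I, ~~ (I \subset U i) -> c i I = 0) ->
  lower w (prod_coef U c) J =
  \sum_i prod_coef U (fun i' => if i' == i then lower w (c i) else c i') J.
Proof.
move/disjoint_familyP => dU c0; rewrite /prod_coef.
case: (boolP (J \subset _)) => JX; last first.
  rewrite mulr0n [RHS]big1 => [|i _]; last by rewrite mul0r.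
  rewrite lowerE big1 // => a _; rewrite subUset (negPf JX) andbF.
  by rewrite mulr0n mul0r mulr0.
rewrite lowerE (bigID (mem (\bigcup_i U i))) /= addrC [X in X + _ = _]big1 ?add0r; last first.
  by move=> a /andP [_ /negPf aX]; rewrite subUset sub1set aX mulr0n mul0r mulr0.
under eq_bigl do rewrite andbC.
rewrite big_mkcondr /= partition_disjoint_bigcup //.
apply: eq_bigr => i _; rewrite mulr1n mul1r [in RHS](bigD1 i) //= eqxx.
have JU : J :&: U i \subset U i by exact: subsetIr.
have -> : lower w (c i) (J :&: U i) =
    \sum_(a in U i | a \notin J) w a * c i (a |: J :&: U i).
  rewrite lowerE (bigID (mem (U i))) /= addrC big1 ?add0r; last first.
    by move=> a /andP [_ aU]; rewrite c0 ?mulr0 // subUset sub1set (negPf aU).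
  by apply: eq_bigl => a; rewrite inE; case: (a \in U i); rewrite ?andbF ?andbT.
rewrite mulr_suml -big_mkcondr /=; apply: eq_bigr => a.
case/andP => aU aJ; rewrite subUset sub1set JX andbT.
have -> : a \in \bigcup_i U i by apply/bigcupP; exists i.
rewrite mul1r (bigD1 i) //= mulrA setIUl; congr (_ * c i (_ :|: _) * _).
  by apply/setIidPl; rewrite sub1set.
apply: eq_bigr => i' i'i; rewrite (negPf i'i) setIUl.
suff -> : [set a] :&: U i' = set0 by rewrite set0U.
apply/eqP; rewrite setI_eq0 disjoints1.
by have /disjointFl := dU _ _ i'i; move/(_ _ aU) => ->.
Qed.

Lemma iter_lower_sum (L : finType) w s (q : L -> {set T} -> S) J :
  iter s (lower w) (fun J => \sum_i q i J) J = \sum_i iter s (lower w) (q i) J.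
Proof.
rewrite iter_lowerE; under eq_bigr do rewrite mulr_suml.
by rewrite exchange_big; apply: eq_bigr => i _; rewrite -iter_lowerE.
Qed.

(* Pigeonhole in the Leibniz rule: #|s| + 1 derivations of a product hit some
   factor twice, or hit a factor outside s. *)
Lemma iter_lower_prod_coef U w (s : {set 'I_l}) c J : disjoint_family U ->
  (forall i I, ~~ (I \subset U i) -> c i I = 0) ->
  (forall i I, i \notin s -> lower w (c i) I = 0) ->
  (forall i I, lower w (lower w (c i)) I = 0) ->
  iter #|s|.+1 (lower w) (prod_coef U c) J = 0.
Proof.
move=> dU; have [m] := ubnP #|s|; elim: m s c J => // m IH s c J.
rewrite ltnS => sm c0 cs cc.
rewrite iterSr; have -> : lower w (prod_coef U c) = (fun J =>
   \sum_i prod_coef U (fun i' => if i' == i then lower w (c i) else c i') J).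
  by apply/funext => I; exact: lower_prod_coef.
rewrite iter_lower_sum big1 // => i _.
have [is_ | iNs] := boolP (i \in s); last first.
  rewrite iter_lowerE big1 // => I _.
  by rewrite /prod_coef [X in _ * X * _](bigD1 i) //= eqxx cs // mul0r mulr0 mul0r.
(* Once factor [i] has been derived, a further derivation kills it, so [i] leaves the exceptional
   set. *)
have cs1 : #|s| = #|s :\ i|.+1 by rewrite (cardsD1 i) is_.
rewrite cs1; apply: IH; first by rewrite -cs1.
- move=> i' I; case: eqP => [->|_] IU; last exact: c0.
  rewrite lowerE big1 // => a _; rewrite c0 ?mulr0 //.
  by apply: contra IU => /(subset_trans _) -> //; exact: subsetUr.
- by move=> i' I; rewrite !inE negb_and negbK; case: eqP => [->|_] //=; exact: cs.
- move=> i' I; case: eqP => [_|//]; rewrite lowerE big1 // => a _.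
  by rewrite cc mulr0.
Qed.

Lemma big_setI_family (R : Type) (idx : R) (op : Monoid.com_law idx) U J
    (F : T -> R) : disjoint_family U -> J \subset \bigcup_i U i ->
  \big[op/idx]_(a in J) F a = \big[op/idx]_i \big[op/idx]_(a in J :&: U i) F a.
Proof.
move/disjoint_familyP => dU JX.
rewrite -(partition_disjoint_bigcup _ (F := fun i => J :&: U i)).
  by apply: eq_bigl => a; rewrite -big_distrr /= (setIidPl JX).
move=> i j /dU; apply: disjointW; exact: subsetIr.
Qed.

End Products.

(** * Lagrange interpolation and the coefficients 1/R *)

Section Lagrange.
Variables (K : fieldType) (T : finType) (z : T -> K).
Implicit Types (A U I J : {set T}).

(** Compares top coefficients in the Lagrange interpolation formula; [f] equals its interpolant [g]
    because both have size at most [#|A|] and agree at [#|A|] points. *)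
Lemma lagrange_lead A (f : {poly K}) : {in A &, injective z} ->
  (size f <= #|A|)%N ->
  \sum_(a in A) f.[z a] / \prod_(b in A :\ a) (z a - z b) = f`_(#|A|.-1).
Proof.
move=> zA szf.
pose den a := \prod_(b in A :\ a) (z a - z b).
have den0 a : a \in A -> den a != 0.
  move=> aA; apply/prodf_neq0 => b; rewrite !inE => /andP [ba bA].
  by rewrite subr_eq0; apply: contra ba => /eqP /zA ->.
have monN (B : {set T}) : \prod_(b in B) ('X - (z b)%:P) \is monic.
  exact: monic_prod_XsubC.
have sN a : a \in A -> size (\prod_(b in A :\ a) ('X - (z b)%:P)) = #|A|.
  by move=> aA; rewrite -big_enum size_prod_XsubC -cardE (cardsD1 a A) aA.
pose g := \sum_(a in A) (f.[z a] / den a) *: \prod_(b in A :\ a) ('X - (z b)%:P).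
have fg : f = g.
  apply/eqP; rewrite -subr_eq0; apply/eqP.
  apply: (@roots_geq_poly_eq0 _ _ [seq z a | a <- enum A]).
  - apply/allP => _ /mapP [a + ->]; rewrite mem_enum => aA.
    rewrite rootE hornerD hornerN horner_sum (bigD1 a) //= [X in _ - (_ + X)]big1.
      rewrite addr0 hornerZ horner_prod -mulrA.
      under eq_bigr do rewrite hornerXsubC.
      by rewrite mulVf ?den0 // mulr1 subrr.
    move=> b /andP [bA ba]; rewrite hornerZ horner_prod (bigD1 a) /=; last first.
      by rewrite !inE eq_sym ba.
    by rewrite hornerXsubC subrr mul0r mulr0.
  - rewrite map_inj_in_uniq ?enum_uniq // => a b; rewrite !mem_enum; exact: zA.
  rewrite size_map -cardE (leq_trans (size_polyD _ _)) // geq_max szf size_polyN.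
  rewrite (leq_trans (size_sum _ _ _)) //; apply/bigmax_leqP => a aA.
  by rewrite (leq_trans (size_scale_leq _ _)) // sN.
rewrite [in RHS]fg coef_sum; apply: eq_bigr => a aA; rewrite coefZ -(sN a aA).
by rewrite -lead_coefE (monicP (monN _)) mulr1.
Qed.

Lemma coef_mul_monic (p F : {poly K}) m : F \is monic -> (size p <= m.+1)%N ->
  (p * F)`_(m + (size F).-1) = p`_m.
Proof.
move=> monF szp; rewrite coefM.
have mlt : (m < (m + (size F).-1).+1)%N by rewrite ltnS leq_addr.
rewrite (bigD1 (Ordinal mlt)) //= addKn -lead_coefE (monicP monF) mulr1 big1 ?addr0 //.
move=> i /eqP im; have [lt|le] := ltnP i m; last first.
  rewrite [p`_i]nth_default ?mul0r // (leq_trans szp) // ltn_neqAle le andbT.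
  by apply/eqP => mi; apply: im; apply: val_inj.
rewrite [F`__]nth_default ?mulr0 //; clear -lt.
by move: (nat_of_ord i) lt => a; move: (size F) => b; lia.
Qed.

Definition vand (A B : {set T}) : K := \prod_(a in A) \prod_(b in B) (z a - z b).

Definition rcoef U r I : K :=
  if (I \subset U) && (#|I| == r) then (vand (U :\: I) I)^-1 else 0.

Lemma lower_rcoef0 U w J : lower w (rcoef U 0) J = 0.
Proof.
rewrite lowerE big1 // => a aJ; rewrite /rcoef cards_eq0.
by rewrite [_ == set0](_ : _ = false) ?andbF ?mulr0 //; apply/set0Pn; exists a; rewrite setU11.
Qed.

(** With A = U \ J and F = prod_(b in J) (X - z_b), the summand at [a] is, up to a common sign and
    the factor 1 / [vand A J], the Lagrange term of p F at z_a. Since F is monic of degree r, the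
    resulting top coefficient of p F is a coefficient of p. *)
Lemma lower_rcoef U r w p J : {in U &, injective z} ->
  (forall a, a \in U -> w a = p.[z a]) -> (size p + r.*2 <= #|U|)%N ->
  lower w (rcoef U r.+1) J =
  (-1) ^+ (#|U| - r).-1 * p`_(#|U| - r.*2).-1 * rcoef U r J.
Proof.
move=> zU wp szp; rewrite lowerE /rcoef.
case: (boolP (J \subset U)) => JU /=; last first.
  rewrite mulr0 big1 // => a _; rewrite subUset (negPf JU) andbF mulr0 //.
have [Jr|Jr] := eqVneq #|J| r; last first.
  rewrite mulr0 big1 // => a aJ; rewrite cardsU1 aJ eqSS (negPf Jr) andbF mulr0 //.
have cA : #|U :\: J| = (#|U| - r)%N by rewrite cardsD (setIidPr JU) Jr.
set A := U :\: J in cA *.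
have AU a : a \in A -> a \in U by rewrite inE => /andP [].
have zA : {in A &, injective z} by move=> a b /AU aU /AU bU; exact: zU.
pose F := \prod_(b in J) ('X - (z b)%:P).
have monF : F \is monic by exact: monic_prod_XsubC.
have szF : size F = r.+1 by rewrite /F -big_enum size_prod_XsubC -cardE Jr.
have vA0 : vand A J != 0.
  apply/prodf_neq0 => a; rewrite inE => /andP [aJ aU]; apply/prodf_neq0 => b bJ.
  rewrite subr_eq0; apply: contra aJ => /eqP /zU -> //.
  exact: (subsetP JU).
have szpF : (size (p * F)%R <= #|A|)%N.
  have := size_polyMleq p F; rewrite szF cA; move: szp.
  by move: (size p) (size (p * F)%R) #|U| => a b d; lia.
have -> : p`_(#|U| - r.*2).-1 = (p * F)`_(#|A|.-1).
  (* If the difference is 0, the predecessor in the index is truncated, but the size bound then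
     forces [p = 0]. *)
  have [U2r|U2r] := posnP (#|U| - r.*2).
    have -> : p = 0.
      apply/eqP; rewrite -size_poly_leq0; move: szp U2r.
      by move: (size p) #|U| => a b; lia.
    by rewrite mul0r !coef0.
  have -> : #|A|.-1 = ((#|U| - r.*2).-1 + (size F).-1)%N.
    by rewrite cA szF /=; move: U2r; lia.
  rewrite coef_mul_monic //; move: szp U2r.
  by move: (size p) #|U| => a b; lia.
rewrite -(lagrange_lead zA szpF) mulr_sumr mulr_suml -cA.
rewrite (bigID (mem U)) /= addrC big1 ?add0r; last first.
  by move=> a /andP [_ /negPf aU]; rewrite subUset sub1set aU mulr0.
apply: eq_big => [a|a /andP [aJ aU]]; first by rewrite inE.
rewrite subUset sub1set aU JU cardsU1 aJ Jr eqxx /= (wp a aU).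
rewrite hornerM horner_prod; under eq_bigr do rewrite hornerXsubC.
have aA : a \in A by rewrite inE aJ.
have den0 : \prod_(b in A :\ a) (z a - z b) != 0.
  apply/prodf_neq0 => b; rewrite !inE => /and3P [ba _ bU].
  by rewrite subr_eq0; apply: contra ba => /eqP /zU ->.
have F0 : \prod_(b in J) (z a - z b) != 0.
  by have /prodf_neq0 := vA0; apply.
have -> : U :\: (a |: J) = A :\ a by apply/setP => b; rewrite !inE negb_or andbA.
have -> : vand (A :\ a) (a |: J) =
    (-1) ^+ #|A|.-1 * \prod_(b in A :\ a) (z a - z b) *
    (vand A J / \prod_(b in J) (z a - z b)).
  rewrite /vand (bigD1 a aA) /= mulrC [X in X / _]mulrC mulfK //.
  have -> : #|A|.-1 = #|A :\ a| by rewrite (cardsD1 a A) aA.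
  rewrite -(GRing.prodrN (mem (A :\ a))).
  rewrite [X in X * _](eq_bigl (mem (A :\ a))); last first.
    by move=> b; rewrite andbC; symmetry; apply: in_setD1.
  rewrite -big_split; apply: eq_bigr => b bA /=.
  by rewrite big_setU1 //= opprB mulrC.
rewrite !invfM invrK invr_sign; field.
by rewrite den0 vA0.
Qed.

End Lagrange.

(** * Coefficients of the block polynomials *)

Section BlockCoefficients.
Variables (S : comNzRingType) (T : finType).
Implicit Types (u v : T -> S) (U I : {set T}).

(** Equals u_a u_b (z_a - z_b) for z = v / u, and still makes sense for a point at infinity, where
    u_a = 0. *)
Definition cross u v a b : S := v a * u b - v b * u a.

Definition half_subset U I := (I \subset U) && (#|I| == #|U|./2).

(** Substituting z = v / u in 1/R and rescaling each x_a by u_a gives a power of prod_(a in U) u_a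
    times [bnum / bden]: the exponents are equal on [I] and [U :\: I] for odd [#|U|], and differ by
    one for even [#|U|]. *)
Definition bnum u U I : S := if odd #|U| then 1 else \prod_(a in U :\: I) u a.

Definition bden u v U I : S :=
  \prod_(a in U :\: I) \prod_(b in I) cross u v a b.

Definition discriminant u v U : S :=
  \prod_(a in U) \prod_(b in U | b != a) cross u v a b.

(** The numerator left after clearing denominators by [discriminant]. It involves no division, so it
    lives over a ring of parameters and commutes with specialisation. *)
Definition bpoly u v U I : S :=
  if half_subset U I then
    bnum u U I * \prod_(a in U)
      \prod_(b in U | (b != a) && ~~ ((a \notin I) && (b \in I))) cross u v a b
  else 0.

End BlockCoefficients.

Lemma bpoly_rmorph (S S' : comNzRingType) (T : finType) (f : {rmorphism S -> S'})
    (u v : T -> S) U I : f (bpoly u v U I) = bpoly (f \o u) (f \o v) U I.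
Proof.
rewrite /bpoly; case: ifP => _; last by rewrite rmorph0.
rewrite rmorphM rmorph_prod /bnum; congr (_ * _).
  by case: ifP => _; rewrite (rmorph1, rmorph_prod).
apply: eq_bigr => a _; rewrite rmorph_prod; apply: eq_bigr => b _.
by rewrite rmorphB !rmorphM.
Qed.

(** * Products of block polynomials are conformal blocks *)

Section BlockFunctions.
Variables (K : numFieldType) (T : finType) (l : nat).
Implicit Types (u v w z : T -> K) (X I J : {set T}) (U : {ffun 'I_l -> {set T}}).

(* The coefficient of x_I in P^(U)(mu) for mu the balanced partition of #|U|,
   written in homogeneous coordinates z = v / u and up to a factor depending
   on U only. *)
Definition bcoef u v (U : {set T}) I : K :=
  if half_subset U I then bnum u U I / bden u v U I else 0.

Lemma bpolyE u v (U : {set T}) I :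
  (forall a b, a \in U -> b \in U -> b != a -> cross u v a b != 0) ->
  bpoly u v U I = discriminant u v U * bcoef u v U I.
Proof.
move=> uv0; rewrite /bpoly /bcoef; case: ifP => [/andP [IU _]|]; last by rewrite mulr0.
have bden0 : bden u v U I != 0.
  apply/prodf_neq0 => a; rewrite inE => /andP [aI aU]; apply/prodf_neq0 => b bI.
  apply: uv0 => //; first exact: (subsetP IU).
  by apply: contraNneq aI => <-.
suff -> : discriminant u v U = bden u v U I * \prod_(a in U)
      \prod_(b in U | (b != a) && ~~ ((a \notin I) && (b \in I))) cross u v a b.
  by field.
have -> : bden u v U I =
    \prod_(a in U) \prod_(b in I | a \notin I) cross u v a b.
  rewrite [RHS](bigID (mem I)) /= [X in _ = X * _]big1 ?mul1r.
    rewrite /bden; apply: eq_big => a; first by rewrite inE andbC.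
    by rewrite inE => /andP [aI _]; rewrite aI; under [RHS]eq_bigl do rewrite andbT.
  by move=> a /andP [_ aI]; rewrite big1 // => b; rewrite aI andbF.
rewrite -big_split; apply: eq_bigr => a aU /=.
rewrite (bigID (fun b => (a \notin I) && (b \in I))) /=; congr (_ * _); last first.
  by apply: eq_bigl => b; rewrite andbA.
apply: eq_bigl => b; case: (boolP (b \in I)) => bI; rewrite ?andbF ?andbT //=.
rewrite (subsetP IU) //=; case: (boolP (a \in I)) => aI; rewrite ?andbF ?andbT //=.
by apply: contraNneq aI => <-.
Qed.

Lemma bcoef_standard z (U : {set T}) I :
  bcoef (fun=> 1) z U I = rcoef z U #|U|./2 I.
Proof.
rewrite /bcoef /rcoef /half_subset; case: ifP => // _.
have -> : bnum (fun=> 1 : K) U I = 1 by rewrite /bnum big1_eq if_same.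
rewrite mul1r; congr _^-1; apply: eq_bigr => a _; apply: eq_bigr => b _.
by rewrite /cross !mulr1.
Qed.

Lemma bcoef_standardE z (U : {set T}) : bcoef (fun=> 1) z U = rcoef z U #|U|./2.
Proof. by apply/funext => I; exact: bcoef_standard. Qed.

(** For nonzero [#|U|./2], [lower_rcoef] reads the coefficient of degree 1 (even [#|U|]) or 2 (odd
    [#|U|]) of p. Both vanish for p = 1; for p = 'X only the odd case does, which is used in the
    next lemma. *)
Lemma lower1_bcoef z (U : {set T}) J : {in U &, injective z} ->
  lower (fun=> 1) (bcoef (fun=> 1) z U) J = 0.
Proof.
move=> zU; rewrite bcoef_standardE; have e := odd_double_half #|U|.
case: #|U|./2 e => [|r] e; first exact: lower_rcoef0.
rewrite (@lower_rcoef _ _ _ _ _ _ 1) //.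
- have -> : (1 : {poly K})`_(#|U| - r.*2).-1 = 0.
    by rewrite coef1; case: eqP => //; move: e; rewrite doubleS; lia.
  by rewrite mulr0 mul0r.
- by move=> a _; rewrite hornerC.
by rewrite size_poly1; move: e; rewrite doubleS; lia.
Qed.

Lemma lowerz_bcoef_odd z (U : {set T}) J : {in U &, injective z} ->
  odd #|U| -> lower z (bcoef (fun=> 1) z U) J = 0.
Proof.
move=> zU oU; rewrite bcoef_standardE; have e := odd_double_half #|U|.
rewrite oU in e; case: #|U|./2 e => [|r] e; first exact: lower_rcoef0.
rewrite (@lower_rcoef _ _ _ _ _ _ 'X) //.
- have -> : ('X : {poly K})`_(#|U| - r.*2).-1 = 0.
    by rewrite coefX; case: eqP => //; move: e; rewrite doubleS; lia.
  by rewrite mulr0 mul0r.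
- by move=> a _; rewrite hornerX.
by rewrite size_polyX; move: e; rewrite doubleS; lia.
Qed.

Lemma lowerz2_bcoef z (U : {set T}) J : {in U &, injective z} ->
  lower z (lower z (bcoef (fun=> 1) z U)) J = 0.
Proof.
move=> zU; have [oU|eU] := boolP (odd #|U|).
  by rewrite lowerE big1 // => a _; rewrite lowerz_bcoef_odd ?mulr0.
rewrite bcoef_standardE; have e := odd_double_half #|U|.
rewrite (negPf eU) add0n in e; case: #|U|./2 e => [|r] e.
  by rewrite lowerE big1 // => a _; rewrite lower_rcoef0 mulr0.
have -> : lower z (rcoef z U r.+1) = fun I =>
    ((-1) ^+ (#|U| - r).-1 * 'X`_(#|U| - r.*2).-1) * rcoef z U r I.
  apply/funext => I; rewrite (@lower_rcoef _ _ _ _ _ _ 'X) //.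
    by move=> a _; rewrite hornerX.
  by rewrite size_polyX -e doubleS.
have -> (k : K) : lower z (fun I => k * rcoef z U r I) J = k * lower z (rcoef z U r) J.
  by rewrite !lowerE mulr_sumr; apply: eq_bigr => a _; rewrite mulrCA.
(* The second application reads the coefficient of degree 3 of 'X. *)
case: r e => [|r] e; first by rewrite lower_rcoef0 mulr0.
rewrite (@lower_rcoef _ _ _ _ _ _ 'X) //.
- have -> : ('X : {poly K})`_(#|U| - r.*2).-1 = 0.
    by rewrite coefX; case: eqP => //; move: e; rewrite !doubleS; lia.
  by rewrite mulr0 mul0r mulr0.
- by move=> a _; rewrite hornerX.
by rewrite size_polyX; move: e; rewrite !doubleS; lia.
Qed.

Definition qcoef u v U : {set T} -> K := prod_coef U (fun i => bcoef u v (U i)).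

(** For k = lambda_2 and [#|X|] = |lambda| the last clause says that d(lambda) blocks are odd. *)
Definition block_partition X k U :=
  [&& disjoint_family U, \bigcup_i U i == X
    & #|[set i | odd #|U i|]| + k.*2 == #|X|]%N.

(** A nonzero coefficient at [J] forces [J] to take half, rounded down, of each block; the halves
    add up to ([#|X|] minus the number of odd blocks) / 2 = k. *)
Lemma qcoef_supp u v U X k J : block_partition X k U -> ~~ wt X k J ->
  qcoef u v U J = 0.
Proof.
case/and3P => dU /eqP UX /eqP oddk wtJ; apply/eqP; apply: contraNT wtJ.
rewrite /qcoef /prod_coef; case: (boolP (J \subset _)); last by rewrite mul0r eqxx.
rewrite UX => JX; rewrite mul1r => /prodf_neq0 bJ; rewrite /wt JX /=.
have halfJ i : #|J :&: U i| = #|U i|./2.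
  by have := bJ i isT; rewrite /bcoef /half_subset; case: ifP => [/andP [_ /eqP]|]; rewrite ?eqxx.
have cJ : #|J| = (\sum_i #|U i|./2)%N.
  rewrite -sum1_card (big_setI_family _ _ dU) ?UX //.
  by apply: eq_bigr => i _; rewrite sum1_card halfJ.
have cX : #|X| = (\sum_i #|U i|)%N.
  rewrite -sum1_card (big_setI_family _ _ dU) ?UX //.
  apply: eq_bigr => i _; rewrite sum1_card (setIidPr _) //.
  by rewrite -UX; exact: bigcup_sup.
have e1 : #|[set i | odd #|U i|]| = (\sum_i odd #|U i|)%N.
  by rewrite -sum1_card big_mkcond; apply: eq_bigr => i _; rewrite inE; case: odd.
have e2 : (\sum_i (#|U i|./2).*2)%N = (\sum_i #|U i|./2).*2.
  by rewrite -muln2 big_distrl; apply: eq_bigr => i _; rewrite /= muln2.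
have e3 : (\sum_i #|U i| = \sum_i odd #|U i| + \sum_i (#|U i|./2).*2)%N.
  by rewrite -big_split; apply: eq_bigr => i _; rewrite /= odd_double_half.
move: oddk; rewrite cX e1 e3 e2 => /eqP; rewrite eqn_add2l -cJ => /eqP kJ.
by rewrite -(doubleK k) kJ doubleK.
Qed.

Lemma cardC_odd_blocks U :
  #|[set i | ~~ odd #|U i|]| = (l - #|[set i | odd #|U i|]|)%N.
Proof.
have -> : [set i | ~~ odd #|U i|] = ~: [set i | odd #|U i|].
  by apply/setP => i; rewrite !inE.
by rewrite cardsCs setCK card_ord.
Qed.

Lemma block_sub X k U i : block_partition X k U -> U i \subset X.
Proof. by case/and3P => _ /eqP <- _; exact: bigcup_sup. Qed.

Lemma qcoef_blocks_standard z U X k s : {in X &, injective z} ->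
  block_partition X k U -> (s + #|X| = l + k.*2 + 1)%N ->
  blocks (fun=> 1) z X k s (qcoef (fun=> 1) z U).
Proof.
move=> zX pU sX; have /and3P [dU /eqP UX /eqP oddk] := pU.
have zU i : {in U i &, injective z}.
  move=> a b /(subsetP (block_sub i pU)) aX /(subsetP (block_sub i pU)); exact: zX.
have b0 u v i I : ~~ (I \subset U i) -> bcoef u v (U i) I = 0.
  by rewrite /bcoef /half_subset => /negPf ->.
split=> [J|J|J]; first exact: qcoef_supp.
  (* Every factor is killed by one derivation, so the exceptional set is empty. *)
  rewrite -[lower _ _ _]/(iter 1 _ _ _) -(cards0 'I_l).
  apply: iter_lower_prod_coef => // [i I|i I _|i I]; first exact: b0.
    by rewrite lower1_bcoef.
  by rewrite lowerE big1 // => a _; rewrite lower1_bcoef ?mulr0.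
(* The numerical hypothesis says that [s] exceeds the number of even blocks by one, and the even
   blocks form the exceptional set. *)
have -> : s = #|[set i | ~~ odd #|U i|]|.+1.
  have := max_card [set i | odd #|U i|]; rewrite card_ord cardC_odd_blocks.
  by move: oddk sX; lia.
apply: iter_lower_prod_coef => // [i I|i I|i I]; first exact: b0.
  2: by rewrite lowerz2_bcoef.
by rewrite inE negbK => ?; rewrite lowerz_bcoef_odd.
Qed.

Definition spanned u v X k (c : {set T} -> K) : Prop :=
  exists b, forall J, c J = \sum_(U | block_partition X k U) b U * qcoef u v U J.

(** * Change of homogeneous coordinates *)

Section Scaling.
Variables (w : T -> K).
Hypothesis w0 : forall a, w a != 0.
Local Notation "u ** w" := (fun a => u a * w a) (at level 40).

Definition bscale (U : {set T}) : K :=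
  (if odd #|U| then 1 else \prod_(a in U) w a) / (\prod_(a in U) w a) ^+ #|U|./2.

Lemma prod_w0 (I : {set T}) : \prod_(a in I) w a != 0.
Proof. exact/prodf_neq0. Qed.

Lemma bscale_neq0 (U : {set T}) : bscale U != 0.
Proof.
rewrite /bscale mulf_neq0 ?invr_neq0 ?expf_neq0 ?prod_w0 //.
by case: ifP; rewrite ?oner_eq0 ?prod_w0.
Qed.

(** With p and q the products of w over [I] and [U :\: I], the total factor is p / (q^r p^(r+1)) for
    odd and p q / (q^r p^r) for even [#|U|], where r = [#|U|./2]; in both cases it depends on p q
    only, hence on [U] only. *)
Lemma bcoef_scale u v (U : {set T}) I :
  (\prod_(a in I) w a) * bcoef (u ** w) (v ** w) U I = bscale U * bcoef u v U I.
Proof.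
rewrite /bcoef; case: ifP => [/andP [IU /eqP Ir]|]; last by rewrite !mulr0.
set p := \prod_(a in I) w a; pose q := \prod_(a in U :\: I) w a.
have pq : \prod_(a in U) w a = p * q.
  rewrite (bigID (mem I)) /=; congr (_ * _); apply: eq_bigl => a; last first.
    by rewrite inE andbC.
  by rewrite andb_idl //; exact: (subsetP IU).
have cUI : #|U :\: I| = (#|U|./2 + odd #|U|)%N.
  rewrite cardsD (setIidPr IU) Ir -{1}(odd_double_half #|U|); lia.
have -> : bden (u ** w) (v ** w) U I =
    q ^+ #|U|./2 * p ^+ (#|U|./2 + odd #|U|) * bden u v U I.
  rewrite /bden -{1}Ir -cUI /q /p -!prodrXl.
  have -> : \prod_(a in I) w a ^+ #|U :\: I| =
      \prod_(a in U :\: I) \prod_(b in I) w b.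
    by rewrite exchange_big; apply: eq_bigr => b _; rewrite prodr_const.
  rewrite -!big_split; apply: eq_bigr => a _ /=.
  rewrite -prodr_const -!big_split; apply: eq_bigr => b _ /=.
  by rewrite /cross; ring.
have [p0 q0] : p != 0 /\ q != 0 by rewrite !prod_w0.
rewrite /bscale /bnum pq exprMn !invfM exprD; case: odd => /=.
  rewrite expr1 !invfM; move: (_ ^+ _)^-1 (_ ^+ _)^-1 (bden _ _ _ _)^-1 => *.
  by field.
rewrite expr0 mulr1 big_split /= -/q.
by move: (_ ^+ _)^-1 (_ ^+ _)^-1 (bden _ _ _ _)^-1 => *; ring.
Qed.

Definition qscale U : K := \prod_i bscale (U i).

Lemma qscale_neq0 U : qscale U != 0.
Proof. by apply/prodf_neq0 => i _; exact: bscale_neq0. Qed.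

Lemma qcoef_scale u v U J : disjoint_family U ->
  (\prod_(a in J) w a) * qcoef (u ** w) (v ** w) U J = qscale U * qcoef u v U J.
Proof.
move=> dU; rewrite /qcoef /prod_coef.
case: (boolP (J \subset _)) => JX; last by rewrite !mul0r !mulr0.
rewrite !mul1r (big_setI_family _ _ dU) //= -!big_split /=.
by apply: eq_bigr => i _; exact: bcoef_scale.
Qed.

Lemma blocks_scale u v X k s c :
  blocks (u ** w) (v ** w) X k s c <->
  blocks u v X k s (fun J => (\prod_(a in J) w a) * c J).
Proof.
have E1 J := lower_scale u w 1 c J; have Es J := lower_scale v w s c J.
split=> -[c1 c2 c3]; split=> J; rewrite ?Es ?[lower u _ J]E1 /=.
- by move=> /c1 ->; rewrite mulr0.
- by rewrite c2 mulr0.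
- by rewrite c3 mulr0.
- by move=> /c1 /eqP; rewrite mulf_eq0 (negPf (prod_w0 J)) => /eqP.
- by have := c2 J; rewrite [lower u _ J]E1 => /eqP; rewrite mulf_eq0 (negPf (prod_w0 J)) => /eqP.
- by have := c3 J; rewrite Es => /eqP; rewrite mulf_eq0 (negPf (prod_w0 J)) => /eqP.
Qed.

Lemma spanned_scale u v X k s :
  (forall c, blocks u v X k s c -> spanned u v X k c) ->
  forall c, blocks (u ** w) (v ** w) X k s c -> spanned (u ** w) (v ** w) X k c.
Proof.
move=> span c /blocks_scale /span [b bE]; exists (fun U => b U / qscale U) => J.
apply: (mulfI (prod_w0 J)); rewrite bE mulr_sumr; apply: eq_bigr => U pU.
rewrite [RHS]mulrCA qcoef_scale; last by case/and3P: pU.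
by rewrite [RHS]mulrA divfK ?qscale_neq0.
Qed.

Lemma qcoef_blocks_scale u v U X k s : disjoint_family U ->
  blocks (u ** w) (v ** w) X k s (qcoef (u ** w) (v ** w) U) ->
  blocks u v X k s (qcoef u v U).
Proof.
move=> dU /blocks_scale /blocksP b0; apply/blocksP => j.
apply: (mulfI (qscale_neq0 U)); rewrite mulr0 -[RHS](b0 j) mulr_sumr.
by apply: eq_bigr => J _; rewrite qcoef_scale // mulrCA.
Qed.

End Scaling.

End BlockFunctions.

(** * Perturbation, and one point at infinity *)

Section Spanning.
Variables (K : numFieldType) (T : finType) (l : nat).
Implicit Types (u v w z : T -> K) (X I J : {set T}) (U : {ffun 'I_l -> {set T}}).
Local Notation spanned := (@spanned K T l).

Lemma spanned0 u v X k c : (forall J, c J = 0) -> spanned u v X k c.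
Proof.
by move=> c0; exists (fun=> 0) => J; rewrite c0 big1 // => U _; rewrite mul0r.
Qed.

Lemma spannedD u v X k c c' : spanned u v X k c -> spanned u v X k c' ->
  spanned u v X k (fun J => c J + c' J).
Proof.
case=> b bE [b' b'E]; exists (fun U => b U + b' U) => J.
by rewrite bE b'E -big_split; apply: eq_bigr => U _; rewrite mulrDl.
Qed.

Lemma spanned_sum (L : finType) (P : pred L) u v X k (b : L -> K)
    (f : L -> {ffun 'I_l -> {set T}}) :
  (forall i, P i -> block_partition X k (f i)) ->
  spanned u v X k (fun J => \sum_(i | P i) b i * qcoef u v (f i) J).
Proof.
move=> Pf; exists (fun U => \sum_(i | P i && (f i == U)) b i) => J.
rewrite (partition_big f (block_partition X k)) //=; apply: eq_bigr => U _.
by rewrite mulr_suml; apply: eq_bigr => i /andP [_ /eqP ->].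
Qed.

Definition distinct_points (u v : T -> K) X :=
  forall a b, a \in X -> b \in X -> b != a -> cross u v a b != 0.

Lemma qpolyE (S : comNzRingType) (ev : {rmorphism S -> K}) (us vs : T -> S) X k U J :
  distinct_points (ev \o us) (ev \o vs) X -> block_partition X k U ->
  ev (prod_coef U (fun i => bpoly us vs (U i)) J) =
  (\prod_i discriminant (ev \o us) (ev \o vs) (U i)) * qcoef (ev \o us) (ev \o vs) U J.
Proof.
move=> dX pU; rewrite /qcoef -prod_coef_scale /prod_coef rmorphM rmorph_nat.
rewrite rmorph_prod; congr (_ * _); apply: eq_bigr => i _.
rewrite bpoly_rmorph bpolyE // => a b aU bU; apply: dX; exact: (subsetP (block_sub i pU)).
Qed.

Lemma discriminants_neq0 u v X k U : distinct_points u v X ->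
  block_partition X k U -> \prod_i discriminant u v (U i) != 0.
Proof.
move=> dX pU; apply/prodf_neq0 => i _; apply/prodf_neq0 => a aU.
apply/prodf_neq0 => b /andP [bU ba].
by apply: dX => //; exact: (subsetP (block_sub i pU)).
Qed.

(** Specialises [spanning_open] to the generators made of [bpoly]; these differ from the [qcoef] by
    products of discriminants, which are nonzero as long as the points are distinct. *)
Lemma spanned_open (S : comNzRingType) (ev0 : {rmorphism S -> K}) (us vs : T -> S)
    X k s :
  distinct_points (ev0 \o us) (ev0 \o vs) X ->
  (forall c, blocks (ev0 \o us) (ev0 \o vs) X k s c ->
     spanned (ev0 \o us) (ev0 \o vs) X k c) ->
  exists2 f : S, ev0 f != 0 & forall ev : {rmorphism S -> K}, ev f != 0 ->
    distinct_points (ev \o us) (ev \o vs) X ->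
    (forall U, block_partition X k U ->
       blocks (ev \o us) (ev \o vs) X k s (qcoef (ev \o us) (ev \o vs) U)) ->
    forall c, blocks (ev \o us) (ev \o vs) X k s c ->
     spanned (ev \o us) (ev \o vs) X k c.
Proof.
move=> d0 span0.
pose G U J : S := if block_partition X k U
  then prod_coef U (fun i => bpoly us vs (U i)) J else 0.
have eqnP (ev : {rmorphism S -> K}) c :
    blocks (ev \o us) (ev \o vs) X k s c <->
    forall j, \sum_J ev (blocks_eqn us vs X k s j J) * c J = 0.
  rewrite blocksP; split=> c0 j; rewrite -[RHS](c0 j); apply: eq_bigr => J _;
    by rewrite blocks_eqn_rmorph.
have spanP (ev : {rmorphism S -> K}) c : distinct_points (ev \o us) (ev \o vs) X ->
    spanned (ev \o us) (ev \o vs) X k c <->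
    exists b, forall J, c J = \sum_U b U * ev (G U J).
  move=> dX.
  pose D U := \prod_i discriminant (ev \o us) (ev \o vs) (U i).
  have GE U J : ev (G U J) = if block_partition X k U
      then D U * qcoef (ev \o us) (ev \o vs) U J else 0.
    by rewrite /G; case: ifP => [/qpolyE ->|]; rewrite ?rmorph0.
  split=> -[b bE].
    exists (fun U => b U / D U) => J; rewrite bE big_mkcond.
    apply: eq_bigr => U _; rewrite GE; case: ifP => pU; last by rewrite mulr0.
    by rewrite [RHS]mulrA divfK // (discriminants_neq0 dX pU).
  exists (fun U => b U * D U) => J; rewrite bE [RHS]big_mkcond.
  apply: eq_bigr => U _; rewrite GE; case: ifP => pU; last by rewrite mulr0.
  by rewrite [LHS]mulrA.
have := @spanning_open S K _ _ _ (blocks_eqn us vs X k s) G ev0.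
case=> [c /eqnP /span0 /spanP|f f0 fP]; first exact.
exists f => // ev evf dX qb c cb; apply/spanP => //; apply: fP => //; last exact/eqnP.
move=> U j; rewrite /G; have [pU|_] := boolP (block_partition X k U); last first.
  by apply: big1 => J _; rewrite rmorph0 mulr0.
have /eqnP /(_ j) q0 := qb U pU.
under eq_bigr do rewrite (qpolyE _ dX pU) mulrCA.
by rewrite -mulr_sumr q0 mulr0.
Qed.

(** * Adding a point to a block *)

Section Attach.
Variables (n : T).

Definition attach i U : {ffun 'I_l -> {set T}} :=
  [ffun j => if j == i then n |: U j else U j].

Variables (X : {set T}) (k : nat) (U : {ffun 'I_l -> {set T}}) (i : 'I_l).
Hypotheses (nX : n \notin X) (pU : block_partition X k U).

Lemma notin_block j : n \notin U j.
Proof. by apply: contra nX; exact: (subsetP (block_sub j pU)). Qed.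

Lemma attach_disjoint : disjoint_family (attach i U).
Proof.
have /and3P [/disjoint_familyP dU _ _] := pU; apply/disjoint_familyP => j j' jj'.
rewrite !ffunE; case: (eqVneq j i) => [ji|_]; case: (eqVneq j' i) => [j'i|_].
- by rewrite ji j'i eqxx in jj'.
- by rewrite -setI_eq0 setIUl setU_eq0 !setI_eq0 disjoints1 notin_block dU.
- by rewrite disjoint_sym -setI_eq0 setIUl setU_eq0 !setI_eq0 disjoints1 notin_block
             disjoint_sym dU.
- exact: dU.
Qed.

Lemma attach_cover : \bigcup_j attach i U j = n |: X.
Proof.
have /and3P [_ /eqP UX _] := pU; rewrite -UX (bigD1 i) //= [in RHS](bigD1 i) //=.
rewrite ffunE eqxx -setUA; congr (_ :|: (_ :|: _)).
by apply: eq_bigr => j /negPf ji; rewrite ffunE ji.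
Qed.

Lemma card_attach j : #|attach i U j| = ((j == i) + #|U j|)%N.
Proof. by rewrite ffunE; case: eqP => // _; rewrite cardsU1 notin_block. Qed.

(** The number of odd blocks and [#|X|] both grow by one, so [k] stays. In [attach_odd] the former
    drops while the latter grows, so [k] grows by one. *)
Lemma attach_even : ~~ odd #|U i| -> block_partition (n |: X) k (attach i U).
Proof.
move=> ei; have /and3P [_ _ /eqP cU] := pU.
rewrite /block_partition attach_disjoint attach_cover eqxx cardsU1 nX -cU /=.
have -> : [set j | odd #|attach i U j|] = i |: [set j | odd #|U j|].
  apply/setP => j; rewrite !inE card_attach.
  by case: eqP => [->|] //=; rewrite ei.
by rewrite cardsU1 inE ei addnA.
Qed.

Lemma attach_odd : odd #|U i| -> block_partition (n |: X) k.+1 (attach i U).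
Proof.
move=> oi; have /and3P [_ _ /eqP cU] := pU.
rewrite /block_partition attach_disjoint attach_cover eqxx cardsU1 nX -cU /=.
have -> : [set j | odd #|attach i U j|] = [set j | odd #|U j|] :\ i.
  apply/setP => j; rewrite !inE card_attach.
  by case: eqP => [->|] //=; rewrite oi.
by rewrite (cardsD1 i [set j | odd #|U j|]) inE oi doubleS /= -addnA !addnS.
Qed.

End Attach.

Lemma eq_bcoef u v u' v' (U : {set T}) I : I \subset U ->
  {in U, u =1 u'} -> {in U, v =1 v'} -> bcoef u v U I = bcoef u' v' U I.
Proof.
move=> IU uu' vv'; rewrite /bcoef; case: ifP => // _; congr (_ / _).
  rewrite /bnum; case: ifP => // _; apply: eq_bigr => a.
  by rewrite inE => /andP [_ /uu'].
apply: eq_bigr => a; rewrite inE => /andP [_ aU]; apply: eq_bigr => b.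
by move=> /(subsetP IU) bU; rewrite /cross !uu' ?vv'.
Qed.

(* The point n is moved to infinity. *)
Section Degenerate.
Variables (n : T) (z : T -> K).
Let u0 a : K := if a == n then 0 else 1.
Let v0 a : K := if a == n then 1 else z a.

(** At infinity [cross n b] is 1 for each finite point b, so the new denominator factors
    disappear. *)
Lemma bcoef_attach_even (C : {set T}) I : n \notin C -> n \notin I ->
  ~~ odd #|C| -> bcoef u0 v0 (n |: C) I = bcoef (fun=> 1) z C I.
Proof.
move=> nC nI eC; rewrite /bcoef /half_subset cardsU1 nC /= uphalf_half (negPf eC) add0n.
have -> : (I \subset n |: C) = (I \subset C).
  apply/idP/idP => [|/subset_trans ->//]; last exact: subsetUr.
  move=> /subsetP IC; apply/subsetP => a aI; have := IC a aI.
  by rewrite !inE; case: eqP => // an; rewrite -an aI in nI.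
case: ifP => // /andP [/subsetP IC _].
have Cn a : a \in C -> a == n = false by apply: contraTF => /eqP ->.
rewrite /bnum cardsU1 nC /= (negPf eC) /= big1 //; congr (_ / _); rewrite /bden.
have -> : (n |: C) :\: I = n |: (C :\: I).
  by apply/setP => a; rewrite !inE; case: eqP => // ->; rewrite nI.
rewrite big_setU1 ?inE ?negb_and ?nC ?orbT //= big1 ?mul1r => [|b /IC bC].
  apply: eq_bigr => a; rewrite inE => /andP [_ aC]; apply: eq_bigr => b /IC bC.
  by rewrite /cross /u0 /v0 !Cn.
by rewrite /cross /u0 /v0 (Cn b bC) eqxx mulr0 subr0 mulr1.
Qed.

(** For an even block the numerator contains u_n = 0 as soon as [n] lies outside [I]. *)
Lemma bcoef_attach_odd0 (C : {set T}) I : n \notin I ->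
  ~~ odd #|n |: C| -> bcoef u0 v0 (n |: C) I = 0.
Proof.
move=> nI eC; rewrite /bcoef; case: ifP => // _.
rewrite /bnum (negPf eC) (bigD1 n) /= ?inE ?eqxx ?nI //.
by rewrite /u0 eqxx !mul0r.
Qed.

(** Each [cross a n] is -1, and there are [#|C|./2.+1] points a in [C :\: I]. *)
Lemma bcoef_attach_odd (C : {set T}) I : n \notin C -> n \notin I -> odd #|C| ->
  bcoef u0 v0 (n |: C) (n |: I) = (-1) ^+ #|C|./2.+1 * bcoef (fun=> 1) z C I.
Proof.
move=> nC nI oC; rewrite /bcoef /half_subset !cardsU1 nC nI /= uphalf_half oC !add1n.
have -> : (n |: I \subset n |: C) = (I \subset C).
  apply/idP/idP => [|/setUS ->//].
  move=> /subsetP IC; apply/subsetP => a aI; have := IC a; rewrite !inE aI orbT.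
  by move=> /(_ isT); case: eqP => // an; rewrite -an aI in nI.
rewrite eqSS; case: ifP => [/andP [/subsetP IC /eqP cI]|]; last by rewrite mulr0.
have Cn a : a \in C -> a == n = false by apply: contraTF => /eqP ->.
have CI : (n |: C) :\: (n |: I) = C :\: I.
  apply/setP => a; rewrite !inE; case: eqP => // ->.
  by rewrite (negPf nC) andbF.
rewrite /bnum cardsU1 nC /= oC CI /= big1 => [|a]; last first.
  by rewrite inE => /andP [_ /Cn aC]; rewrite /u0 aC.
have -> : bden u0 v0 (n |: C) (n |: I) =
    (-1) ^+ #|C|./2.+1 * bden (fun=> 1) z C I.
  have -> : #|C|./2.+1 = #|C :\: I|.
    rewrite cardsD (setIidPr _); last exact/subsetP.
    by rewrite cI -{2}(odd_double_half #|C|) oC; lia.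
  rewrite /bden CI -prodr_const -big_split; apply: eq_bigr => a.
  rewrite inE => /andP [_ /Cn aC]; rewrite big_setU1 //=; congr (_ * _).
    by rewrite /cross /u0 /v0 aC eqxx mulr0 sub0r mulr1.
  by apply: eq_bigr => b /IC /Cn bC; rewrite /cross /u0 /v0 aC bC.
by rewrite !mul1r invfM invr_sign.
Qed.

Variables (X : {set T}) (k : nat) (U : {ffun 'I_l -> {set T}}).
Hypotheses (nX : n \notin X) (pU : block_partition X k U).

Lemma bcoef_other j I : I \subset U j ->
  bcoef u0 v0 (U j) I = bcoef (fun=> 1) z (U j) I.
Proof.
move=> IU; apply: eq_bcoef => // a aU; rewrite /u0 /v0;
  by case: eqP => // an; have := notin_block nX pU j; rewrite -an aU.
Qed.

Lemma attach_sub i J : n \notin J ->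
  (J \subset \bigcup_j attach n i U j) = (J \subset \bigcup_j U j).
Proof.
move=> nJ; rewrite (attach_cover n i pU); have /and3P [_ /eqP -> _] := pU.
apply/idP/idP => [|/subset_trans ->//]; last exact: subsetUr.
move=> /subsetP JX; apply/subsetP => a aJ; have := JX a aJ.
by rewrite !inE; case: eqP => // an; rewrite -an aJ in nJ.
Qed.

Lemma attach_setI i j J : n \notin J -> J :&: attach n i U j = J :&: U j.
Proof.
move=> nJ; rewrite ffunE; case: eqP => // _; rewrite setIUr.
suff -> : J :&: [set n] = set0 by rewrite set0U.
by apply/eqP; rewrite setI_eq0 disjoint_sym disjoints1.
Qed.

Lemma qcoef_attach_even i J : n \notin J -> ~~ odd #|U i| ->
  qcoef u0 v0 (attach n i U) J = qcoef (fun=> 1) z U J.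
Proof.
move=> nJ ei; rewrite /qcoef /prod_coef attach_sub //; congr (_ * _).
apply: eq_bigr => j _; rewrite attach_setI // ffunE; case: eqP => [->|_].
  by rewrite bcoef_attach_even ?(notin_block nX pU) // inE (negPf nJ).
by rewrite bcoef_other ?subsetIr.
Qed.

Lemma qcoef_attach_odd0 i J : n \notin J -> odd #|U i| ->
  qcoef u0 v0 (attach n i U) J = 0.
Proof.
move=> nJ oi; rewrite /qcoef /prod_coef [X in _ * X](bigD1 i) //= ffunE eqxx.
rewrite bcoef_attach_odd0 ?mul0r ?mulr0 //; first by rewrite inE (negPf nJ).
by rewrite cardsU1 (notin_block nX pU) /= oi.
Qed.

Lemma qcoef_attach_odd i J : n \notin J -> odd #|U i| ->
  qcoef u0 v0 (attach n i U) (n |: J) =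
  (-1) ^+ #|U i|./2.+1 * qcoef (fun=> 1) z U J.
Proof.
move=> nJ oi; rewrite /qcoef /prod_coef mulrCA; congr (_ * _).
  rewrite -(attach_sub i nJ) subUset sub1set (attach_cover n i pU).
  by rewrite setU11.
rewrite (bigD1 i) //= [in RHS](bigD1 i) //= mulrA ffunE eqxx -setUIr.
rewrite bcoef_attach_odd ?(notin_block nX pU) // ?inE ?negb_and ?nJ //.
congr (_ * _); apply: eq_bigr => j ji; rewrite ffunE (negPf ji) setIUl.
have -> : [set n] :&: U j = set0.
  by apply/eqP; rewrite setI_eq0 disjoints1 (notin_block nX pU).
by rewrite set0U bcoef_other ?subsetIr.
Qed.

End Degenerate.

End Spanning.

(** * Induction on the number of points *)

Section Induction.
Variables (K : numFieldType) (T : finType) (l : nat).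
Implicit Types (u v w z : T -> K) (X I J : {set T}) (U : {ffun 'I_l -> {set T}}).
Local Notation spanned := (@spanned K T l).
Local Notation qcoef := (@qcoef K T l).

(** All [k] occur at once, since removing a point changes d = [#|X|] - 2k by one in either
    direction. The relation means s = l - d + 1. *)
Definition good X z : Prop := {in X &, injective z} /\
  forall k s, (s + #|X| = l + k.*2 + 1)%N ->
  forall c, blocks (fun=> 1) z X k s c -> spanned (fun=> 1) z X k c.

Definition attach_parity (p : bool) (n : T) U : {ffun 'I_l -> {set T}} :=
  if [pick i | odd #|U i| == p] is Some i then attach n i U else U.

(** * Spanning with one point at infinity *)

Section Degenerate.
Variables (n : T) (z : T -> K) (X : {set T}).
Hypothesis nX : n \notin X.
Hypothesis goodX : good X z.
Let u0 a : K := if a == n then 0 else 1.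
Let v0 a : K := if a == n then 1 else z a.

Let u0n : u0 n = 0. Proof. by rewrite /u0 eqxx. Qed.
Let v0n : v0 n = 1. Proof. by rewrite /v0 eqxx. Qed.

Lemma iter_lower_u0 s c : (forall J, n \in J -> c J = 0) ->
  iter s (lower u0) c = iter s (lower (fun=> 1)) c.
Proof. by apply: eq_iter_lower_supp => a /negPf an; rewrite /u0 an. Qed.

Lemma iter_lower_v0 s c : (forall J, n \in J -> c J = 0) ->
  iter s (lower v0) c = iter s (lower z) c.
Proof. by apply: eq_iter_lower_supp => a /negPf an; rewrite /v0 an. Qed.

Lemma part_without_n (c : {set T} -> K) J : n \in J -> part_without n c J = 0.
Proof. by rewrite /part_without => ->. Qed.

Lemma part_with_n (c : {set T} -> K) J : n \in J -> part_with n c J = 0.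
Proof. by rewrite /part_with => ->. Qed.

(** The x_n part of c is killed by the power s+1 of the second operator, hence c without x_n by the
    power s+2; for the first operator u_n = 0 decouples the two components. *)
Lemma blocks_part_without k s c : blocks u0 v0 (n |: X) k s.+1 c ->
  blocks (fun=> 1) z X k s.+2 (part_without n c).
Proof.
case=> c1 c2 c3; split; first exact: part_without_supp.
  move=> J; rewrite -[lower _ _]/(iter 1 _ _) -iter_lower_u0; last exact: part_without_n.
  have := part_without_lower u0 n c J; rewrite u0n mul0r addr0 /= => <-.
  by rewrite /part_without c2 if_same.
move=> J; rewrite -iter_lower_v0; last exact: part_without_n.
have := part_without_iter v0 n c s.+2 J; rewrite -[s.+2.-1]/s.+1 -part_with_iter.
rewrite /part_with c3 if_same mulr0 addr0 => <-.
rewrite /part_without iterS lowerE big1 ?if_same // => a _.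
by rewrite c3 mulr0.
Qed.

Lemma blocks_part_with k s c : blocks u0 v0 (n |: X) k.+1 s.+1 c ->
  (forall J, part_without n c J = 0) ->
  blocks (fun=> 1) z X k s (part_with n c).
Proof.
case=> c1 c2 c3 A0; split.
- by move=> J wtJ; apply: (part_with_supp c1).
- move=> J; rewrite -[lower _ _]/(iter 1 _ _) -iter_lower_u0; last exact: part_with_n.
  by rewrite /= -part_with_lower /part_with c2 if_same.
move=> J; rewrite -iter_lower_v0; last exact: part_with_n.
have := part_without_iter v0 n c s.+1 J.
have -> : part_without n c = fun=> 0 by apply/funext.
have -> : iter s.+1 (lower v0) (fun=> 0 : K) J = 0.
  by rewrite iter_lowerE big1 // => L _; rewrite mul0r.
rewrite /part_without c3 if_same add0r v0n mulr1 => /esym/eqP.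
by rewrite mulf_eq0 pnatr_eq0 => /eqP.
Qed.

Lemma degenerate_spanned k s : (k.*2 <= #|X|.+1)%N ->
  (s + #|X|.+1 = l + k.*2 + 1)%N ->
  (forall U, block_partition (n |: X) k U ->
     blocks u0 v0 (n |: X) k s (qcoef u0 v0 U)) ->
  forall c, blocks u0 v0 (n |: X) k s c -> spanned u0 v0 (n |: X) k c.
Proof.
case: s => [|s] kX sX qb c cb; first by apply: spanned0 => J; case: cb.
have [_ goodXP] := goodX.
(* If all l blocks were odd then l + 2k = [#|X|], against [sX] with a positive exponent. *)
have evenP U : block_partition X k U -> exists2 i, ~~ odd #|U i| &
    attach_parity false n U = attach n i U.
  move=> pU; rewrite /attach_parity; case: pickP => [i /eqP ei|none].
    by exists i => //; rewrite ei.
  have /and3P [_ _ /eqP] := pU.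
  have -> : [set i | odd #|U i|] = setT.
    by apply/setP => i; have := none i; rewrite !inE; case: odd.
  by rewrite cardsT card_ord; move: sX; lia.
pose sgn U : K := if [pick i | odd #|U i| == true] is Some i
  then (-1) ^+ #|U i|./2.+1 else 1.
(* Without odd blocks 2k' = [#|X|], against 2k' + 2 <= [#|X|] + 1. *)
have oddP k' U : k = k'.+1 -> block_partition X k' U -> exists2 i, odd #|U i| &
    attach_parity true n U = attach n i U /\ sgn U = (-1) ^+ #|U i|./2.+1.
  move=> kk' pU; rewrite /attach_parity /sgn; case: pickP => [i /eqP ei|none].
    by exists i => //; rewrite ei.
  have /and3P [_ _ /eqP] := pU.
  have -> : [set i | odd #|U i|] = set0.
    by apply/setP => i; have := none i; rewrite !inE; case: odd.
  by rewrite cards0; move: sX kX; rewrite kk' doubleS; lia.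
have [b bE] : spanned (fun=> 1) z X k (part_without n c).
  by apply: (goodXP k s.+2); [move: sX; lia | exact: blocks_part_without].
pose q U := if block_partition X k U
  then qcoef u0 v0 (attach_parity false n U) else (fun=> 0).
pose c1 J := \sum_(U | block_partition X k U)
  b U * qcoef u0 v0 (attach_parity false n U) J.
have c1E J : c1 J = \sum_U b U * q U J.
  rewrite /c1 big_mkcond; apply: eq_bigr => U _; rewrite /q.
  by case: ifP => // _; rewrite mulr0.
(* Still a block, and its component without x_n is zero. *)
pose c2 J := c J - \sum_U b U * q U J.
have c2b : blocks u0 v0 (n |: X) k s.+1 c2.
  apply: blocks_sub => // U; rewrite /q; case: ifP => pU.
    have [i ei ->] := evenP U pU; exact/qb/(attach_even nX pU).
  by apply/blocksP => j; rewrite big1 // => J _; rewrite mulr0.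
have A2 J : part_without n c2 J = 0.
  have := bE J; rewrite /part_without /c2 -c1E /c1; case: ifPn => // nJ ->.
  apply/eqP; rewrite subr_eq0; apply/eqP/eq_bigr => U pU.
  by have [i ei ->] := evenP U pU; rewrite (qcoef_attach_even _ nX pU).
have -> : c = fun J => c1 J + c2 J.
  by apply/funext => J; rewrite c1E /c2 addrC subrK.
apply: spannedD.
  by apply: spanned_sum => U pU; have [i ei ->] := evenP U pU; exact: attach_even.
have [k0|k_gt0] := posnP k.
  apply: spanned0 => J; rewrite (split_partsE n c2) A2.
  case: c2b => c2s _ _; rewrite (part_with_supp c2s) ?if_same // k0.
  by [].
have kk' := esym (prednK k_gt0); move: (k.-1) kk' => k' kk'.
have := c2b; rewrite kk' => /blocks_part_with /(_ A2) /(goodXP k' s) [].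
  by move: sX; rewrite kk' doubleS; lia.
move=> b' b'E.
(* These products have no component without x_n, and [sgn] cancels the sign in
   [qcoef_attach_odd]. *)
have -> : c2 = fun J => \sum_(U | block_partition X k' U)
    (b' U * sgn U) * qcoef u0 v0 (attach_parity true n U) J.
  apply/funext => J; rewrite (split_partsE n c2) A2; case: ifPn => nJ.
    have nJ' : n \notin J :\ n by rewrite !inE eqxx.
    rewrite b'E; apply: eq_bigr => U pU; have [i oi [-> ->]] := oddP _ _ kk' pU.
    rewrite -{2}(setD1K nJ) (qcoef_attach_odd _ nX pU) //.
    by rewrite -[RHS]mulrA signrMK.
  rewrite big1 // => U pU; have [i oi [-> _]] := oddP _ _ kk' pU.
  by rewrite (qcoef_attach_odd0 _ nX pU) ?mulr0.
rewrite -kk'; apply: spanned_sum => U pU; have [i oi [-> _]] := oddP _ _ kk' pU.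
by rewrite kk'; exact: attach_odd.
Qed.

End Degenerate.

(** Only constants occur, and they are multiples of the product over l empty blocks, which is 1. *)
Lemma good_set0 z : good set0 z.
Proof.
split=> [a b|k s sk c [c1 c2 c3]]; first by rewrite inE.
have [k0|k_gt0] := posnP k; last first.
  apply: spanned0 => J; apply: c1; apply/andP => -[].
  by rewrite subset0 => /eqP -> ; rewrite cards0 => /eqP k0; rewrite -k0 in k_gt0.
have p0 : block_partition set0 k [ffun _ : 'I_l => set0 : {set T}].
  apply/and3P; split.
  - by apply/disjoint_familyP => i j _; rewrite !ffunE -setI_eq0 setI0.
  - by rewrite big1 // => i _; rewrite ffunE.
  rewrite k0 cards0 addn0 cards_eq0; apply/eqP/setP => i.
  by rewrite !inE ffunE cards0.
exists (fun U => if U == [ffun _ => set0] then c set0 else 0) => J.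
rewrite (bigD1 _ p0) /= eqxx big1 => [|U /andP [_ /negPf ->]]; last by rewrite mul0r.
rewrite addr0 /qcoef /prod_coef.
have -> : \bigcup_i [ffun _ : 'I_l => set0 : {set T}] i = set0.
  by rewrite big1 // => i _; rewrite ffunE.
rewrite subset0; have [->|J0] := eqVneq J set0; last first.
  by rewrite mul0r mulr0 c1 // /wt subset0 (negPf J0).
rewrite mul1r big1 ?mulr1 // => i _; rewrite ffunE setI0 /bcoef /half_subset.
rewrite sub0set !cards0 /= /bnum /bden set0D cards0 /=.
by rewrite !big_set0 divr1.
Qed.

(** Above the middle degree [lower (fun=> 1)] is injective, so the only block is 0. *)
Lemma spanned_above z X k s c : (#|X| < k.*2)%N ->
  blocks (fun=> 1) z X k s c -> spanned (fun=> 1) z X k c.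
Proof.
move=> Xk [c1 c2 _]; apply: spanned0; apply: (iter_lower_inj (X := X) (k := k) (j := 1)) => //.
by rewrite addn1.
Qed.

Lemma poly_neq0_point (p : {poly K}) : p != 0 -> exists x, p.[x] != 0.
Proof.
move=> p0; pose r := [seq i%:R : K | i <- iota 0 (size p)].
have ur : uniq r by rewrite map_inj_uniq ?iota_uniq // => i j /eqP; rewrite eqr_nat => /eqP.
have : ~~ all (root p) r.
  apply/negP => /roots_geq_poly_eq0 /(_ ur); rewrite size_map size_iota leqnn.
  by move=> /(_ isT) /eqP; rewrite (negPf p0).
by case/allPn => x _; exists x.
Qed.

(** * Moving the new point from infinity to a finite position *)

Section Step.
Variables (n : T) (z : T -> K) (X : {set T}).
Hypothesis nX : n \notin X.
Hypothesis goodX : good X z.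

(** The parameter e gives [n] the coordinates (u, v) = (e, 1), so z_n = 1/e and e = 0 is
    infinity. *)
Let us a : {poly K} := if a == n then 'X else 1.
Let vs a : {poly K} := if a == n then 1 else (z a)%:P.
Let move_n e a : K := if a == n then e^-1 else z a.
(** Nonzero at e exactly when 1/e is finite and differs from all z_a. *)
Let h : {poly K} := 'X * \prod_(a in X) (1 - (z a)%:P * 'X).

Let usE e : horner_eval e \o us = fun a => if a == n then e else 1.
Proof.
by apply/funext => a; rewrite /= /horner_eval /us; case: eqP; rewrite (hornerX, hornerC).
Qed.

Let vsE e : horner_eval e \o vs = fun a => if a == n then 1 else z a.
Proof.
by apply/funext => a; rewrite /= /horner_eval /vs; case: eqP; rewrite hornerC.
Qed.

Let distinct_at e : (forall a, a \in X -> 1 - z a * e != 0) ->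
  distinct_points (horner_eval e \o us) (horner_eval e \o vs) (n |: X).
Proof.
move=> he a b; rewrite usE vsE /cross => /setU1P [->|aX] /setU1P [->|bX].
- by rewrite eqxx.
- move=> /negPf bn; rewrite eqxx bn mulr1; exact: he.
- move=> ba; rewrite eqxx; have /negPf -> : a != n by rewrite eq_sym.
  by rewrite mulr1 -opprB oppr_eq0 he.
have /negPf -> : a != n by apply: contraNneq nX => <-.
have /negPf -> : b != n by apply: contraNneq nX => <-.
have [zX _] := goodX.
by rewrite !mulr1 subr_eq0 eq_sym; apply: contra => /eqP /zX ->.
Qed.

Let hP e : h.[e] != 0 -> e != 0 /\ forall a, a \in X -> 1 - z a * e != 0.
Proof.
rewrite /h hornerM hornerX horner_prod mulf_eq0 negb_or => /andP [e0 /prodf_neq0 he].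
split=> // a aX; have := he a aX.
by rewrite hornerD hornerN hornerM hornerX !hornerC.
Qed.

Let h0 : h != 0.
Proof.
rewrite mulf_neq0 ?polyX_eq0 //; apply/prodf_neq0 => a _; apply/eqP.
move=> /(congr1 (horner^~ 0)); rewrite hornerD hornerN hornerM hornerX !hornerC.
by rewrite mulr0 subr0 => /eqP; rewrite oner_eq0.
Qed.

Let w e a : K := if a == n then e^-1 else 1.

Let w_neq0 e : e != 0 -> forall a, w e a != 0.
Proof. by move=> e0 a; rewrite /w; case: (a == n); rewrite ?invr_eq0 ?oner_eq0. Qed.

Let usw e : e != 0 -> (fun a => (horner_eval e \o us) a * w e a) = fun=> 1.
Proof.
move=> e0; apply/funext => a; rewrite usE /w; case: eqP => _; last by rewrite mulr1.
by rewrite divff.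
Qed.

Let vsw e : (fun a => (horner_eval e \o vs) a * w e a) = move_n e.
Proof.
apply/funext => a; rewrite vsE /w /move_n; case: eqP => _; by rewrite ?mul1r ?mulr1.
Qed.

Let move_n_inj e : h.[e] != 0 -> {in n |: X &, injective (move_n e)}.
Proof.
move=> /hP [e0 he].
have ne b : b \in X -> e^-1 != z b.
  move=> bX; apply: contra (he b bX) => /eqP <-; by rewrite mulVf // subrr.
have Xn b : b \in X -> b == n = false by apply: contraTF => /eqP ->.
have [zX _] := goodX.
move=> a b; rewrite /move_n => /setU1P [->|aX] /setU1P [->|bX] //.
- by rewrite eqxx Xn // => /eqP; rewrite (negPf (ne b bX)).
- by rewrite eqxx Xn // => /esym /eqP; rewrite (negPf (ne a aX)).
by rewrite !Xn //; exact: zX.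
Qed.

Let qcoef_blocks_at k s U e : block_partition (n |: X) k U ->
  (s + #|n |: X| = l + k.*2 + 1)%N -> h.[e] != 0 ->
  blocks (horner_eval e \o us) (horner_eval e \o vs) (n |: X) k s
    (qcoef (horner_eval e \o us) (horner_eval e \o vs) U).
Proof.
move=> pU sX he; have [e0 _] := hP he.
apply: (qcoef_blocks_scale (w_neq0 e0)); first by case/and3P: pU.
rewrite usw // vsw; apply: qcoef_blocks_standard => //; exact: move_n_inj.
Qed.

(* A polynomial identity in the position of the point n extends to infinity. *)
Let qcoef_blocks_at0 k s U : block_partition (n |: X) k U ->
  (s + #|n |: X| = l + k.*2 + 1)%N ->
  blocks (horner_eval 0 \o us) (horner_eval 0 \o vs) (n |: X) k s
    (qcoef (horner_eval 0 \o us) (horner_eval 0 \o vs) U).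
Proof.
move=> pU sX; apply/blocksP => j.
pose q J := prod_coef U (fun i => bpoly us vs (U i)) J.
pose p := \sum_J blocks_eqn us vs (n |: X) k s j J * q J.
have dist0 : distinct_points (horner_eval 0 \o us) (horner_eval 0 \o vs) (n |: X).
  by apply: distinct_at => a _; rewrite mulr0 subr0 oner_eq0.
have pE e : distinct_points (horner_eval e \o us) (horner_eval e \o vs) (n |: X) ->
    p.[e] = (\prod_i discriminant (horner_eval e \o us) (horner_eval e \o vs) (U i))
    * \sum_J blocks_eqn (horner_eval e \o us) (horner_eval e \o vs) (n |: X) k s j J
      * qcoef (horner_eval e \o us) (horner_eval e \o vs) U J.
  move=> de; rewrite horner_sum mulr_sumr; apply: eq_bigr => J _.
  rewrite hornerM -[(q J).[e]]/(horner_eval e (q J)) (qpolyE _ de pU) mulrCA.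
  by rewrite -[_.[e]]/(horner_eval e _) blocks_eqn_rmorph.
have p0 : p = 0.
  apply/eqP; apply/negPn/negP => p0.
  (* A nonzero p would be nonzero at some e with h(e) nonzero, where the points are finite and
     distinct and the equation is known. *)
  have [e] := poly_neq0_point (mulf_neq0 p0 h0).
  rewrite hornerM mulf_eq0 negb_or => /andP [pe he].
  have [_ /distinct_at de] := hP he.
  have /blocksP /(_ j) b0 := qcoef_blocks_at pU sX he.
  by rewrite pE // b0 mulr0 eqxx in pe.
have := pE 0 dist0; rewrite p0 horner0 => /esym/eqP.
by rewrite mulf_eq0 (negPf (discriminants_neq0 dist0 pU)) => /eqP.
Qed.

Lemma good_setU1 : exists z', good (n |: X) z'.
Proof.
have cX : #|n |: X| = #|X|.+1 by rewrite cardsU1 nX.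
have dist0 : distinct_points (horner_eval 0 \o us) (horner_eval 0 \o vs) (n |: X).
  by apply: distinct_at => a _; rewrite mulr0 subr0 oner_eq0.
(* One exceptional polynomial per [k]. Only [k] up to half of [#|n |: X|] matter, the rest being
   covered by [spanned_above], so a finite product of the [f k] suffices below. *)
have /choice [f fP] k : exists f : {poly K}, f.[0] != 0 /\
    forall e, f.[e] != 0 -> h.[e] != 0 -> (k.*2 <= #|n |: X|)%N ->
    forall s, (s + #|n |: X| = l + k.*2 + 1)%N ->
    forall c, blocks (horner_eval e \o us) (horner_eval e \o vs) (n |: X) k s c ->
    spanned (horner_eval e \o us) (horner_eval e \o vs) (n |: X) k c.
  have [s0|ns] := leqP #|n |: X| (l + k.*2 + 1); last first.
    exists 1; split=> [|e _ _ _ s sX]; first by rewrite hornerC oner_eq0.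
    by move: ns; rewrite -sX; lia.
  have [kX|nk] := leqP k.*2 #|n |: X|; last first.
    exists 1; split=> [|e _ _ //]; first by rewrite hornerC oner_eq0.
  pose s := (l + k.*2 + 1 - #|n |: X|)%N.
  have sE : (s + #|n |: X| = l + k.*2 + 1)%N by rewrite subnK.
  have sp0 c : blocks (horner_eval 0 \o us) (horner_eval 0 \o vs) (n |: X) k s c ->
      spanned (horner_eval 0 \o us) (horner_eval 0 \o vs) (n |: X) k c.
    have := qcoef_blocks_at0 _ sE; rewrite usE vsE => qb.
    have kX' : (k.*2 <= #|X|.+1)%N by rewrite -cX.
    have sE' : (s + #|X|.+1 = l + k.*2 + 1)%N by rewrite -cX.
    exact: (degenerate_spanned nX goodX kX' sE' qb).
  have [f f0 fP] := spanned_open dist0 sp0.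
  exists f; split=> // e fe he _ s' s'E.
  have -> : s' = s by apply/eqP; rewrite -(eqn_add2r #|n |: X|) s'E sE.
  have [_ /distinct_at de] := hP he.
  by apply: (fP (horner_eval e)) => // U pU; exact: qcoef_blocks_at.
have g0 : \prod_(k < #|n |: X|.+1) f k * h != 0.
  rewrite mulf_neq0 //; apply/prodf_neq0 => k _; have [+ _] := fP k.
  by apply: contraNneq => ->; rewrite horner0.
have [e] := poly_neq0_point g0; rewrite hornerM mulf_eq0 negb_or horner_prod.
case/andP => /prodf_neq0 fe he; have [e0 _] := hP he.
exists (move_n e); split; first exact: move_n_inj.
move=> k s sX; have [kX|kX] := leqP k.*2 #|n |: X|; last first.
  by move=> c; exact: spanned_above.
have kle : (k < #|n |: X|.+1)%N by rewrite ltnS; move: kX; lia.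
have [_ /(_ e (fe (Ordinal kle) isT) he kX s sX) span] := fP k.
by have := spanned_scale (w_neq0 e0) span; rewrite usw // vsw.
Qed.

End Step.

Lemma exists_good X : exists z, good X z.
Proof.
have [m] := ubnP #|X|; elim: m X => // m IH X; rewrite ltnS => Xm.
have [->|[n nX]] := set_0Vmem X; first by exists (fun=> 0); exact: good_set0.
have [|z gz] := IH (X :\ n); first by rewrite (cardsD1 n X) nX in Xm.
by rewrite -(setD1K nX); apply: (good_setU1 _ gz); rewrite !inE eqxx.
Qed.

End Induction.

(** * Translation to polynomials *)

Section Polynomials.
Variables (K : numFieldType) (n : nat).
Local Notation idx := (@mxvec_index 2 n).
Local Notation MP := {mpoly K[2 * n]}.
Implicit Types (I J A : {set 'I_n}) (c : {set 'I_n} -> K) (a b : 'I_n).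

Lemma idx_eq i j a b : (idx i a == idx j b) = (i == j) && (a == b).
Proof. by rewrite /mxvec_index (inj_eq (@cast_ord_inj _ _ _)) (inj_eq enum_rank_inj). Qed.

(** A set [I] encodes the monomial with y^(2)_a for a in [I] and y^(1)_a otherwise; these monomials
    form a basis of V^(tensor n). *)
Definition slot I a : 'I_2 := if a \in I then ord_max else ord0.

Definition mmon I : 'X_{1..2 * n} := (\sum_a U_(idx (slot I a) a))%MM.

Definition monom I : MP := \prod_a y K (slot I a) a.

Definition poly_of c : MP := \sum_I c I *: monom I.

Lemma monomE I : monom I = 'X_[mmon I].
Proof. by rewrite -mprodXE. Qed.

Lemma mmonE I i a : mmon I (idx i a) = (slot I a == i).
Proof.
rewrite /mmon mnm_sumE (bigD1 a) //= mnm1E idx_eq eqxx andbT big1 ?addn0 //.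
by move=> b /negPf ba; rewrite mnm1E idx_eq ba andbF.
Qed.

Lemma mmon_inj : injective mmon.
Proof.
move=> I J IJ; apply/setP => a.
have := congr1 (fun m : 'X_{1..2 * n} => m (idx ord_max a)) IJ; rewrite !mmonE /slot.
by case: (a \in I); case: (a \in J).
Qed.

Lemma mcoeff_poly_of c I : (poly_of c)@_(mmon I) = c I.
Proof.
rewrite /poly_of raddf_sum (bigD1 I) //= mcoeffZ monomE mcoeffX eqxx mulr1.
rewrite big1 ?addr0 // => J JI.
by rewrite mcoeffZ monomE mcoeffX (inj_eq mmon_inj) (negPf JI) mulr0.
Qed.

Lemma poly_of_inj c c' : poly_of c = poly_of c' -> c = c'.
Proof. by move=> cc'; apply/funext => I; rewrite -mcoeff_poly_of cc' mcoeff_poly_of. Qed.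

Lemma poly_of0 : poly_of (fun=> 0) = 0.
Proof. by rewrite /poly_of big1 // => I _; rewrite scale0r. Qed.

Lemma poly_of_eq0 c : poly_of c = 0 <-> forall I, c I = 0.
Proof.
split=> [|c0]; first by rewrite -poly_of0 => /poly_of_inj ->.
by rewrite /poly_of big1 // => I _; rewrite c0 scale0r.
Qed.

Lemma poly_of_Vtensor c : Vtensor (poly_of c).
Proof.
move=> m; rewrite mcoeff_msupp => m0 a.
have [I ->] : exists I, m = mmon I.
  apply/not_existsP => none; case/eqP: m0.
  rewrite /poly_of raddf_sum big1 // => I _ /=; rewrite mcoeffZ monomE mcoeffX.
  by case: eqP => [/esym /none|]; rewrite ?mulr0.
by rewrite !mmonE /slot; case: (a \in I).
Qed.

Lemma Vtensor_poly_of (p : MP) : Vtensor p -> p = poly_of (fun I => p@_(mmon I)).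
Proof.
move=> Vp; apply/mpolyP => m.
have [[I ->]|none] := pselect (exists I, m = mmon I); first by rewrite mcoeff_poly_of.
have -> : p@_m = 0.
  apply/eqP; rewrite mcoeff_eq0; apply/negP => /Vp mV; apply: none.
  exists [set a | m (idx ord_max a) != 0%N]; apply/mnmP => k.
  case/mxvec_indexP: k => i a; rewrite mmonE /slot inE.
  have := mV a; have [->|->] : i = ord0 \/ i = ord_max.
    by case: i => [[|[|[]]] ?] //; [left | right]; exact: val_inj.
    case: (m (idx ord_max a)) => [|k]; first by rewrite addn0 => ->.
    by rewrite addnS => -[] /eqP; rewrite addn_eq0 => /andP [/eqP -> _].
  case: (m (idx ord_max a)) => [|k] //; rewrite addnS => -[] /eqP.
  by rewrite addn_eq0 => /andP [_ /eqP ->].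
apply/esym; rewrite /poly_of raddf_sum big1 // => I _ /=.
rewrite mcoeffZ monomE mcoeffX; case: eqP => [Im|_]; last by rewrite mulr0.
by case: none; exists I.
Qed.

Definition upd I a (i : 'I_2) := if i == ord_max then a |: I else I :\ a.

Lemma slot_upd I a i b : slot (upd I a i) b = if b == a then i else slot I b.
Proof.
have [->|->] : i = ord0 \/ i = ord_max.
  by case: i => [[|[|[]]] ?] //; [left | right]; exact: val_inj.
all: by rewrite /upd /slot /= !inE; case: (b == a).
Qed.

Lemma y_dy_monom i j a I :
  y K i a * dy j a (monom I) = (slot I a == j)%:R *: monom (upd I a i).
Proof.
rewrite /dy monomE mderivX mmonE -scalerAr.
case: eqP => [ja|_]; last by rewrite !scale0r.
congr (_ *: _); rewrite monomE /y -mpolyXD; congr 'X_[_]; apply/mnmP => k.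
case/mxvec_indexP: k => i' b; rewrite mnmDE mnmBE !mmonE !mnm1E !idx_eq slot_upd.
rewrite ![a == b]eq_sym; case: (b =P a) => [->|_]; last by rewrite !andbF subn0.
by rewrite !andbT ja subnn addn0.
Qed.

Lemma ez_monom w i j I :
  ez w i j (monom I) = \sum_(a | slot I a == j) w a *: monom (upd I a i).
Proof.
rewrite /ez [RHS]big_mkcond; apply: eq_bigr => a _; rewrite y_dy_monom.
by case: eqP => _; rewrite ?scale1r // scale0r scaler0.
Qed.

Lemma ez_poly_of w i j c : ez w i j (poly_of c) = \sum_I c I *: ez w i j (monom I).
Proof.
rewrite /ez; under [RHS]eq_bigr do rewrite scaler_sumr.
rewrite exchange_big; apply: eq_bigr => a _ /=.
rewrite /dy /poly_of linear_sum mulr_sumr scaler_sumr.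
by apply: eq_bigr => I _; rewrite linearZ -scalerAr !scalerA mulrC.
Qed.

Lemma e_ez i j (p : MP) : e i j p = ez (fun=> 1) i j p.
Proof. by apply: eq_bigr => a _; rewrite scale1r. Qed.

(** Replacing y^(2)_a by y^(1)_a removes [a] from the set, so the new coefficient at [J] collects
    the old ones at [a |: J]. *)
Lemma ez_lower w c : ez w ord0 ord_max (poly_of c) = poly_of (lower w c).
Proof.
rewrite ez_poly_of /poly_of; under eq_bigr do rewrite ez_monom scaler_sumr big_mkcond.
under [RHS]eq_bigr do rewrite lowerE scaler_suml big_mkcond.
rewrite exchange_big [RHS]exchange_big; apply: eq_bigr => a _ /=.
rewrite -big_mkcond -[RHS]big_mkcond /=.
rewrite [RHS](reindex_onto (fun I => I :\ a) (fun J => a |: J)) /=; last first.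
  by move=> J aJ; rewrite setU1K.
apply: eq_big => I; rewrite /slot.
  rewrite !inE eqxx /=; case: (boolP (a \in I)) => aI; first by rewrite setD1K ?eqxx.
  by apply/esym/eqP => e; rewrite -e setU11 in aI.
by case: ifP => // aI _; rewrite setD1K // scalerA mulrC.
Qed.

Lemma iter_ez_lower w s c :
  iter s (ez w ord0 ord_max) (poly_of c) = poly_of (iter s (lower w) c).
Proof. by elim: s => //= s ->; exact: ez_lower. Qed.

Lemma e_diag i c :
  e i i (poly_of c) = poly_of (fun I => #|[set a | slot I a == i]|%:R * c I).
Proof.
rewrite e_ez ez_poly_of; apply: eq_bigr => I _; rewrite ez_monom.
rewrite [_ * c I]mulrC -scalerA scaler_nat -sumr_const; congr (_ *: _).
apply: eq_big => a; first by rewrite inE.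
move=> /eqP ia; rewrite scale1r; congr monom; apply/setP => b.
have := slot_upd I a i b; rewrite /slot; case: eqP => [->|_].
  by rewrite -ia /slot; do 2 case: ifP.
by do 2 case: ifP.
Qed.

Lemma SV_poly_of lam c : psize lam = n ->
  SV lam (poly_of c) <->
  (forall J, ~~ wt setT lam.2 J -> c J = 0) /\ (forall J, lower (fun=> 1) c J = 0).
Proof.
move=> lamn.
have c2 J : [set a | slot J a == ord_max] = J.
  by apply/setP => a; rewrite inE /slot; case: (a \in J).
have c1 J : #|[set a | slot J a == ord0]| = (n - #|J|)%N.
  have -> : [set a | slot J a == ord0] = ~: J.
    by apply/setP => a; rewrite !inE /slot; case: (a \in J).
  by rewrite cardsCs setCK card_ord.
have scaleE x : x *: poly_of c = poly_of (fun I => x * c I).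
  by rewrite /poly_of scaler_sumr; apply: eq_bigr => I _; rewrite scalerA.
rewrite /SV e_ez ez_lower !e_diag !scaleE; split.
  case=> _ /poly_of_eq0 low _ /poly_of_inj e2; split=> // J; rewrite /wt subsetT /=.
  have := congr1 (fun f => f J) e2; rewrite /= c2 => /eqP.
  rewrite -subr_eq0 -mulrBl mulf_eq0 subr_eq0 eqr_nat.
  by case/orP => [->|/eqP].
case=> supp low; split; first exact: poly_of_Vtensor.
- exact/poly_of_eq0.
- congr poly_of; apply/funext => J; have [JW|/supp ->] := boolP (wt setT lam.2 J).
    move: JW => /andP [_ /eqP J2]; rewrite c1 J2 -lamn /psize addnK //.
  by rewrite !mulr0.
congr poly_of; apply/funext => J; have [JW|/supp ->] := boolP (wt setT lam.2 J).
  by move: JW => /andP [_ /eqP J2]; rewrite c2 J2.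
by rewrite !mulr0.
Qed.

Lemma CB_poly_of z l lam c : psize lam = n ->
  CB z l lam (poly_of c) <->
  blocks (fun=> 1) z setT lam.2 (l - pdiff lam + 1) c.
Proof.
move=> lamn; rewrite /CB SV_poly_of // iter_ez_lower poly_of_eq0.
by split=> [[[]]|[]].
Qed.

(** A pair (I_1, I_2) is determined by I_2, and the increasing enumeration of [A] identifies I_2
    with a subset [I] of [A]. *)
Lemma P_set_index z A : P (@set_index n A) z =
  \sum_I bcoef (fun=> 1) z A I *: \prod_(a in A) y K (slot I a) a.
Proof.
pose g := @set_index n A.
have g_inj : injective g by move=> a b /enum_val_inj /cast_ord_inj.
have gA i : g i \in A by exact: enum_valP.
have gS b : b \in A -> exists i, b = g i.
  move=> bA; exists (cast_ord (esym (psize_balanced #|A|)) (enum_rank_in bA b)).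
  by rewrite /g /set_index cast_ordKV enum_rankK_in.
have gK (J : {set 'I_(psize (balanced #|A|))}) : g @^-1: (g @: J) = J by apply/setP => a; rewrite inE mem_imset.
have gI I : I \subset A -> g @: (g @^-1: I) = I.
  move=> IA; apply/setP => b; apply/imsetP/idP => [[a + ->]|bI]; first by rewrite inE.
  have [a ba] := gS b (subsetP IA b bI).
  by exists a; rewrite // inE -ba.
have gAD I : g @: (~: (g @^-1: I)) = A :\: I.
  apply/setP => b; apply/imsetP/setDP => [[a + ->]|[/gS [a ->] aI]].
    by rewrite !inE => aI; split.
  by exists a; rewrite // !inE.
rewrite /P -/g (reindex_onto (fun I => (~: (g @^-1: I), g @^-1: I))
   (fun p => g @: p.2)) /=; last first.
  case=> J1 J2 /= /and4P [/setDidPl dJ /eqP cJ _ _]; rewrite gK; congr (_, _).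
  by rewrite -dJ -[in LHS]setTD -cJ setDUl setDv setU0.
have szA := psize_balanced #|A|.
have condE I : [&& [disjoint ~: (g @^-1: I) & g @^-1: I],
    ~: (g @^-1: I) :|: g @^-1: I == [set: 'I_(psize (balanced #|A|))],
    #|~: (g @^-1: I)| == uphalf #|A| & #|g @^-1: I| == #|A|./2]
    && (g @: (g @^-1: I) == I) = half_subset A I.
  rewrite disjoint_sym disjoints_subset setCK subxx setUC setUCr eqxx /=.
  rewrite /half_subset; have [IA|IA] := boolP (I \subset A); last first.
    apply/negP => /andP [_ /eqP e]; case/negP: IA; rewrite -e; apply/subsetP => _ /imsetP [a _ ->]; exact: gA.
  rewrite gI // eqxx andbT -[in RHS](gI I IA) card_imset //.
  case: (_ =P #|A|./2) => [e|_]; rewrite ?andbF //= cardsCs setCK e card_ord szA andbT.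
  by apply/eqP; have := odd_double_half #|A|; rewrite uphalf_half; lia.
rewrite (eq_bigl _ _ condE) big_mkcond /=; apply: eq_bigr => I _.
rewrite bcoef_standard /rcoef -/(half_subset A I).
case: ifP => [/andP [IA _]|]; last by rewrite scale0r.
rewrite [in RHS](bigID (mem I)) /= mulrC; congr (_^-1 *: (_ * _)).
- rewrite /Rprod /vand -(gAD I) big_imset; last by move=> ? ? _ _ /g_inj.
  apply: eq_bigr => a _; rewrite -{2}(gI I IA) big_imset //; by move=> ? ? _ _ /g_inj.
- rewrite [RHS](eq_bigl (mem (g @: (g @^-1: I)))); last first.
    move=> b /=; rewrite gI // andb_idl //; exact: (subsetP IA).
  rewrite big_imset; last by move=> ? ? _ _ /g_inj.
  by apply: eq_bigr => a; rewrite inE /slot /= => ->.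
rewrite [RHS](eq_bigl (mem (g @: (~: (g @^-1: I))))); last first.
  by move=> b /=; rewrite gAD // inE andbC.
rewrite big_imset; last by move=> ? ? _ _ /g_inj.
by apply: eq_bigr => a; rewrite !inE /slot /= => /negPf ->.
Qed.

(** Expanding the product gives a sum over families [f]; only those with [f i \subset U i]
    contribute, and they correspond to sets [J] by [f i = J :&: U i]. *)
Lemma Q_poly_of l z (U : {ffun 'I_l -> {set 'I_n}}) : disjoint_family U ->
  \bigcup_i U i = setT -> Q z U = poly_of (qcoef (fun=> 1) z U).
Proof.
move=> dU UT; rewrite /Q; under eq_bigr do rewrite P_set_index.
rewrite bigA_distr_bigA /=.
under eq_bigr do rewrite scaler_prod.
rewrite (bigID (fun f : {ffun 'I_l -> {set 'I_n}} => [forall i, f i \subset U i])) /=.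
rewrite [X in _ + X]big1 ?addr0; last first.
  move=> f /forallPn [i fi]; rewrite (bigD1 i) //= /bcoef /half_subset (negPf fi).
  by rewrite mul0r scale0r.
rewrite (reindex_onto (fun J => [ffun i => J :&: U i]) (fun f => \bigcup_i f i)) /=.
  apply: eq_big => [J|J _].
    apply/andP; split.
      by apply/forallP => i; rewrite ffunE subsetIr.
    under eq_bigr do rewrite ffunE.
    by rewrite -big_distrr /= UT setIT.
  rewrite /qcoef /prod_coef UT subsetT mul1r; congr (_ *: _).
    by apply: eq_bigr => i _; rewrite ffunE.
  have -> : monom J = \prod_(a in setT) y K (slot J a) a.
    by apply: eq_bigl => a; rewrite inE.
  rewrite (big_setI_family _ _ dU) ?UT //=; apply: eq_bigr => i _; rewrite ffunE setTI.
  by apply: eq_bigr => a aU; rewrite /slot inE aU andbT.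
move=> f /forallP fU; apply/ffunP => i; rewrite ffunE (bigD1 i) //= setIUl.
rewrite (setIidPl (fU i)) big_distrl /= big1 ?setU0 // => j ji.
apply/eqP; rewrite setI_eq0; have /disjoint_familyP /(_ j i ji) := dU.
by apply: disjointWl; exact: fU.
Qed.

End Polynomials.

(** * Passage to generic points *)

Lemma admissible_block_partition l lam (U : {ffun 'I_l -> {set 'I_(psize lam)}}) :
  is_partition lam -> (pdiff lam <= l)%N ->
  admissible lam U = block_partition setT lam.2 U.
Proof.
rewrite /is_partition => hlam hl; rewrite /admissible /block_partition cardC_odd_blocks.
have e : (#|[set i | odd #|U i|]| + lam.2.*2 == #|[set: 'I_(psize lam)]|)%N =
    (#|[set i | odd #|U i|]| == pdiff lam).
  rewrite cardsT card_ord /psize /pdiff; apply/eqP/eqP; move: hlam; lia.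
rewrite e -/(disjoint_family U); congr [&& _, _ & _].
by case: eqP => // ->; rewrite eqxx.
Qed.

Lemma generically_spans (K : numFieldType) (lam : nat * nat) (l : nat) :
  is_partition lam -> (pdiff lam <= l)%N ->
  @generically K (psize lam) (fun z =>
    spans (@admissible (psize lam) l lam) (@Q K (psize lam) l z) (CB z l lam)).
Proof.
move=> hlam hl; pose n := psize lam.
have sE : (l - pdiff lam + 1 + #|[set: 'I_n]| = l + lam.2.*2 + 1)%N.
  move: hl hlam; rewrite /is_partition cardsT card_ord /n /psize /pdiff; lia.
have [z0 [z0_inj good0]] := exists_good K l [set: 'I_n].
(* The universal configuration: evaluation at [z] specialises it to the points [z] in standard
   coordinates. *)
pose us (a : 'I_n) : {mpoly K[n]} := 1; pose vs (a : 'I_n) : {mpoly K[n]} := 'X_a.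
have usE (z : 'I_n -> K) : meval z \o us = fun=> 1.
  by apply/funext => a; exact: meval1.
have vsE (z : 'I_n -> K) : meval z \o vs = z.
  by apply/funext => a; exact: mevalXU.
have dist (z : 'I_n -> K) : {in [set: 'I_n] &, injective z} ->
    distinct_points (meval z \o us) (meval z \o vs) setT.
  move=> z_inj a b _ _; rewrite usE vsE /cross !mulr1 subr_eq0 eq_sym.
  by apply: contra => /eqP /z_inj -> //; rewrite inE.
have span0 c : blocks (meval z0 \o us) (meval z0 \o vs) setT lam.2 (l - pdiff lam + 1) c ->
    spanned l (meval z0 \o us) (meval z0 \o vs) setT lam.2 c.
  by rewrite usE vsE; exact: good0.
have [f f0 fP] := spanned_open (dist z0 z0_inj) span0.
exists (fun z => f.@[z] != 0); split.
- exists (fun g => g = f) => z; split=> [fz|[g -> //]]; by exists f.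
- by exists z0.
move=> z fz z_inj.
have z_injT : {in [set: 'I_n] &, injective z} by move=> a b _ _; exact: z_inj.
have qb (U : {ffun 'I_l -> {set 'I_n}}) : block_partition setT lam.2 U ->
    blocks (fun=> 1) z setT lam.2 (l - pdiff lam + 1) (qcoef (fun=> 1) z U).
  by move=> pU; exact: qcoef_blocks_standard.
have span c : blocks (fun=> 1) z setT lam.2 (l - pdiff lam + 1) c ->
    spanned l (fun=> 1) z setT lam.2 c.
  have := fP (meval z) fz (dist z z_injT); rewrite usE vsE; exact.
have sumE (b : {ffun 'I_l -> {set 'I_n}} -> K) :
    \sum_(U | admissible lam U) b U *: Q z U = poly_of (fun J =>
      \sum_(U | block_partition setT lam.2 U) b U * qcoef (fun=> 1) z U J).
  rewrite (eq_bigl (block_partition setT lam.2)) => [|U]; last first.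
    exact: admissible_block_partition.
  under [RHS]eq_bigr do rewrite scaler_suml.
  rewrite exchange_big; apply: eq_bigr => U /and3P [dU /eqP UT _].
  rewrite Q_poly_of // scaler_sumr; apply: eq_bigr => J _.
  by rewrite scalerA.
move=> p; split=> [CBp|[b ->]].
  have [[Vp _ _ _] _] := CBp; move: CBp; rewrite (Vtensor_poly_of Vp).
  case/(CB_poly_of z l _ erefl)/span => b bE; exists b; rewrite sumE.
  by congr poly_of; apply/funext.
rewrite sumE; apply/(CB_poly_of z l _ erefl).
(* Extended by zero, so that every member of the family indexed by all [U] is a block, as
   [blocks_sum] requires. *)
pose q (U : {ffun 'I_l -> {set 'I_n}}) :=
  if block_partition setT lam.2 U then qcoef (fun=> 1) z U else (fun=> 0).
have := @blocks_sum _ _ _ (fun=> 1) z setT lam.2 (l - pdiff lam + 1)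
  (fun U => b U) q.
have -> : (fun J => \sum_U b U * q U J) = (fun J =>
    \sum_(U | block_partition setT lam.2 U) b U * qcoef (fun=> 1) z U J).
  apply/funext => J; rewrite [RHS]big_mkcond; apply: eq_bigr => U _; rewrite /q.
  by case: ifP => // _; rewrite mulr0.
apply=> U; rewrite /q; case: ifP => [/qb //|_].
by apply/blocksP => j; rewrite big1 // => J _; rewrite mulr0.
Qed.

Theorem theorem7p11 (R : realType) (lam : nat * nat) (l : nat)
    (hlam : is_partition lam) (hl0 : (0 < l)%N) (hl : (pdiff lam <= l)%N) :
  @generically (complex R) (psize lam) (fun z =>
    spans (@admissible (psize lam) l lam) (@Q (complex R) (psize lam) l z)
      (CB z l lam)).
Proof.
exact: (@generically_spans (complex R)).
Qed.
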